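(* There exists a nonempty open subset $\mathcal O$ of the tetrahedral shape space $\mathcal T$ such that every class in $\mathcal O$ admits an LEB branch which remains in a compact subset of the (nondegenerate) shape space $\mathcal T$ and contains infinitely many similarity classes. Moreover, $\mathcal O$ contains a dense full-measure subset such that, for every element of this subset, the entire refinement tree is tie-free.
   Context: A labeled tetrahedron is an ordered quadruple $\Delta=(p_0,p_1,p_2,p_3)$ of affinely independent points of $\mathbb R^3$, with Gram matrix $G(\Delta)=X^{\mathsf T}X$, $X=[\,p_1-p_0\,|\,p_2-p_0\,|\,p_3-p_0\,]$. Labeled tetrahedra are similar iff their Gram matrices are positive multiples of each other, so the space of labeled similarity classes is $\mathcal T_{\mathrm{lab}}=\operatorname{Sym}_3^{>0}/\mathbb R_{>0}$ (positive definite symmetric $3\times 3$ matrices modulo positive scalars); the (nondegenerate) tetrahedral shape space is $\mathcal T=\mathcal T_{\mathrm{lab}}/S_4$, where $S_4$ permutes the vertices, with the quotient topology. A subset of $\mathcal T$ is null if its preimage in $\operatorname{Sym}_3^{>0}$ is Lebesgue null, and a subset of $\mathcal O$ has full measure if its complement in $\mathcal O$ is null. Bisecting a tetrahedron at an edge $p_ip_j$ produces two children: one in which $p_i$ is replaced by the midpoint $\tfrac12(p_i+p_j)$ and one in which $p_j$ is replaced by it, the other vertices being unchanged. An LEB (Longest Edge Bisection) branch of $\Delta$ is an infinite sequence $(\Delta_n)_{n\ge0}$ with $\Delta_0=\Delta$ such that each $\Delta_{n+1}$ is one of the two children obtained by bisecting $\Delta_n$ at some longest edge of $\Delta_n$.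 The refinement tree of $\Delta$ consists of all tetrahedra occurring in LEB branches of $\Delta$; it is tie-free if every tetrahedron in it has a unique longest edge. *)

(* Defs.v *)
From HB Require Import structures.
From mathcomp Require Import all_boot all_order all_algebra all_fingroup.
From mathcomp Require Import all_classical all_reals all_analysis.

Set Implicit Arguments.
Unset Strict Implicit.
Unset Printing Implicit Defensive.

Import Order.TTheory GRing.Theory Num.Theory.
Import numFieldNormedType.Exports.

Local Open Scope classical_set_scope.
Local Open Scope ring_scope.
Local Open Scope quotient_scope.

Section Gram.
Context {R : realType}.

Definition quadruple := {ffun 'I_4 -> 'cV[R]_3}.

Definition affinely_independent (p : quadruple) : bool :=
  free [tuple p (lift ord0 j) - p ord0 | j < 3].

Record labeled_tetrahedron := LabeledTetrahedron {
  vertex :> quadruple;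
  vertex_affinely_independent : affinely_independent vertex }.

Definition edge_mx (p : quadruple) : 'M[R]_3 :=
  \matrix_(k, j) (p (lift ord0 j) - p ord0) k 0.

Definition gram (p : quadruple) : 'M[R]_3 := (edge_mx p)^T *m edge_mx p.

Definition posdef : set 'M[R]_3 :=
  [set G | G^T = G /\
    forall x : 'cV[R]_3, x != 0 -> 0 < (x^T *m G *m x) 0 0].

Lemma sqnorm_ge0 (y : 'cV[R]_3) : 0 <= (y^T *m y) 0 0.
Proof.
by rewrite mxE sumr_ge0// => i _; rewrite mxE -expr2 sqr_ge0.
Qed.

Lemma sqnorm_gt0 (y : 'cV[R]_3) : y != 0 -> 0 < (y^T *m y) 0 0.
Proof.
move=> y0; rewrite lt_neqAle sqnorm_ge0 andbT eq_sym; apply: contra y0.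
rewrite mxE psumr_eq0 => [|i _]; last by rewrite mxE -expr2 sqr_ge0.
move=> /allP h; apply/eqP/colP => i; rewrite mxE.
have := h i (mem_index_enum i); rewrite /= mxE -expr2 sqrf_eq0.
by move/eqP.
Qed.

Lemma posdef_congr (G A : 'M[R]_3) :
  posdef G -> (forall x : 'cV[R]_3, x != 0 -> A *m x != 0) ->
  posdef (A^T *m G *m A).
Proof.
move=> [Gs Gp] Ax; split; first by rewrite !trmx_mul trmxK Gs mulmxA.
by move=> x /Ax/Gp; rewrite trmx_mul !mulmxA.
Qed.

Lemma edge_mx_inj (D : labeled_tetrahedron) (x : 'cV[R]_3) :
  x != 0 -> edge_mx D *m x != 0.
Proof.
apply: contra => /eqP Xx; apply/eqP/colP => j; rewrite [RHS]mxE.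
have /freeP/(_ (fun i => x i 0)) := vertex_affinely_independent D; apply.
apply/colP => k; rewrite summxE -[RHS](congr1 (fun M : 'cV[R]_3 => M k 0) Xx) [RHS]mxE.
apply: eq_bigr => i _.
by rewrite (nth_map ord0) ?size_enum_ord// nth_ord_enum !mxE mulrC.
Qed.

Lemma gram_posdef (D : labeled_tetrahedron) : posdef (gram D).
Proof.
rewrite /gram -[(edge_mx D)^T]mulmx1; apply: posdef_congr (edge_mx_inj D).
by split=> [|x x0]; rewrite ?trmx1// mulmx1 sqnorm_gt0.
Qed.

(* Column j holds the coordinates of p_(s(j+1)) - p_(s 0) in terms of the
   p_(k+1) - p_0. *)
Definition perm_coord (s : 'S_4) : 'M[R]_3 :=
  \matrix_(k, j) ((s (lift ord0 j) == lift ord0 k)%:R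
                  - (s ord0 == lift ord0 k)%:R).

Definition permute (s : 'S_4) (p : quadruple) : quadruple := [ffun i => p (s i)].

Lemma sum_perm_coord (f : 'I_4 -> R) (s : 'S_4) (j : 'I_3) : f ord0 = 0 ->
  \sum_k f (lift ord0 k) * perm_coord s k j = f (s (lift ord0 j)) - f (s ord0).
Proof.
move=> f0; have sumf m : \sum_(k < 3) f (lift ord0 k) * (m == lift ord0 k)%:R = f m.
  transitivity (\sum_(k < 4) f k * (m == k)%:R).
    by rewrite [RHS]big_ord_recl f0 mul0r add0r.
  rewrite (bigD1 m)//= eqxx mulr1 big1 ?addr0// => k.
  by rewrite eq_sym => /negbTE ->; rewrite mulr0.
rewrite -(sumf (s (lift ord0 j))) -(sumf (s ord0)) -sumrB.
by apply: eq_bigr => k _; rewrite mxE mulrBr.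
Qed.

Lemma perm_coord1 : perm_coord 1%g = 1%:M.
Proof.
apply/matrixP => k j; rewrite !mxE !perm1 (inj_eq lift_inj) eq_sym.
by rewrite (negbTE (neq_lift _ _)) subr0.
Qed.

Lemma perm_coordM (s t : 'S_4) :
  perm_coord (t * s)%g = perm_coord s *m perm_coord t.
Proof.
apply/matrixP => i j; rewrite [RHS]mxE [LHS]mxE !permM.
pose f m : R := (s m == lift ord0 i)%:R - (s ord0 == lift ord0 i)%:R.
transitivity (f (t (lift ord0 j)) - f (t ord0)).
  by rewrite /f opprB addrA subrK.
rewrite -sum_perm_coord ?/f ?subrr//.
by apply: eq_bigr => k _; congr (_ * _); rewrite mxE.
Qed.

Lemma gram_permute (s : 'S_4) (p : quadruple) :
  gram (permute s p) = (perm_coord s)^T *m gram p *m perm_coord s.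
Proof.
suff E : edge_mx (permute s p) = edge_mx p *m perm_coord s.
  by rewrite /gram E trmx_mul !mulmxA.
apply/matrixP => k j; rewrite [RHS]mxE [LHS]mxE !ffunE.
pose f m : R := (p m - p ord0) k 0.
transitivity (f (s (lift ord0 j)) - f (s ord0)).
  by rewrite /f !mxE opprB addrA subrK.
rewrite -sum_perm_coord; last by rewrite /f subrr mxE.
by apply: eq_bigr => m _; congr (_ * _); rewrite /f [RHS]mxE.
Qed.

Lemma perm_coord_posdef (s : 'S_4) (G : 'M[R]_3) : posdef G ->
  posdef ((perm_coord s)^T *m G *m perm_coord s).
Proof.
move=> Gp; apply: posdef_congr Gp _ => x; apply: contra => /eqP sx.
by rewrite -[x]mul1mx -perm_coord1 -(mulgV s) perm_coordM -mulmxA sx mulmx0.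
Qed.

Definition gram_of (D : labeled_tetrahedron) : posdef :=
  SigSub (mem_set (gram_posdef D)).

Definition perm_gram (s : 'S_4) (G : posdef) : posdef :=
  SigSub (mem_set (perm_coord_posdef s (set_valP G))).

End Gram.

Arguments quadruple : clear implicits.
Arguments labeled_tetrahedron : clear implicits.
Arguments posdef : clear implicits.

Section ShapeSpace.
Context (R : realType).

Definition scale_rel (G H : posdef R) : bool :=
  `[< exists2 c : R, 0 < c & \val H = c *: \val G >].

Lemma scale_rel_equiv : equiv_class_of scale_rel.
Proof.
split=> [G|G H|H G K].
- by apply/asboolP; exists 1; rewrite ?scale1r.
- apply/asboolP/asboolP => -[c c0 E]; exists c^-1; rewrite ?invr_gt0//;
    by rewrite E scalerA mulVf ?scale1r// gt_eqF.
- move=> /asboolP[c c0 E] /asboolP[d d0 F]; apply/asboolP.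
  by exists (d * c); rewrite ?mulr_gt0// F E scalerA.
Qed.

Canonical scale_equiv := EquivRelPack scale_rel_equiv.

Definition labeled_shape := quotient_topology {eq_quot scale_equiv}.

HB.instance Definition _ := Topological.on labeled_shape.
HB.instance Definition _ := Quotient.on labeled_shape.

Definition labeled_class (G : posdef R) : labeled_shape := \pi_labeled_shape G.

Lemma labeled_classP (G H : posdef R) :
  labeled_class G = labeled_class H <->
  exists2 c : R, 0 < c & \val H = c *: \val G.
Proof.
split=> [/eqquotP/asboolP//|E].
by apply/eqquotP/asboolP.
Qed.

Definition perm_labeled (s : 'S_4) (x : labeled_shape) : labeled_shape :=
  labeled_class (perm_gram s (generic_quotient.repr x)).

Lemma perm_labeledE (s : 'S_4) (G : posdef R) :
  perm_labeled s (labeled_class G) = labeled_class (perm_gram s G).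
Proof.
apply/labeled_classP.
have /labeled_classP[c c0 E] :
  labeled_class (generic_quotient.repr (labeled_class G)) = labeled_class G := reprK _.
by exists c; rewrite //= E -scalemxAr -scalemxAl.
Qed.

Lemma perm_labeled1 (x : labeled_shape) : perm_labeled 1%g x = x.
Proof.
rewrite -[RHS]reprK; congr (labeled_class _); apply: val_inj => /=.
by rewrite perm_coord1 trmx1 mul1mx mulmx1.
Qed.

Lemma perm_labeledM (s t : 'S_4) (x : labeled_shape) :
  perm_labeled (t * s)%g x = perm_labeled t (perm_labeled s x).
Proof.
rewrite [perm_labeled s x]/perm_labeled perm_labeledE.
congr (labeled_class _); apply: val_inj => /=.
by rewrite perm_coordM trmx_mul !mulmxA.
Qed.

Definition relabel_rel (x y : labeled_shape) : bool :=
  [exists s : 'S_4, y == perm_labeled s x].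

Lemma relabel_rel_equiv : equiv_class_of relabel_rel.
Proof.
split=> [x|x y|y x z].
- by apply/existsP; exists 1%g; rewrite perm_labeled1.
- apply/existsP/existsP => -[s /eqP ->]; exists s^-1%g;
    by rewrite -perm_labeledM mulVg perm_labeled1.
- move=> /existsP[s /eqP ->] /existsP[t /eqP ->]; apply/existsP.
  by exists (t * s)%g; rewrite perm_labeledM.
Qed.

Canonical relabel_equiv := EquivRelPack relabel_rel_equiv.

Definition shape_space := quotient_topology {eq_quot relabel_equiv}.

HB.instance Definition _ := Topological.on shape_space.
HB.instance Definition _ := Quotient.on shape_space.

Definition gram_class (G : posdef R) : shape_space :=
  \pi_shape_space (labeled_class G).

Definition tetra_shape (D : labeled_tetrahedron R) : shape_space :=
  gram_class (gram_of D).

Definition sym_coord (G : 'M[R]_3) : R * R * R * R * R * R :=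
  let i0 : 'I_3 := inord 0 in let i1 : 'I_3 := inord 1 in
  let i2 : 'I_3 := inord 2 in
  (G i0 i0, G i1 i1, G i2 i2, G i0 i1, G i0 i2, G i1 i2).

Definition lebesgue6 : set (R * R * R * R * R * R) -> \bar R :=
  (lebesgue_measure \x lebesgue_measure \x lebesgue_measure \x
   lebesgue_measure \x lebesgue_measure \x @lebesgue_measure R)%E.

Definition null (A : set shape_space) : Prop :=
  lebesgue6.-negligible
    [set sym_coord (\val G) | G in gram_class @^-1` A].

End ShapeSpace.

Section Bisection.
Context {R : realType}.

(* The norm of the library on 'cV[R]_3 is the sup norm. *)
Definition euclidean_dist (u v : 'cV[R]_3) : R :=
  Num.sqrt (\sum_k (u k 0 - v k 0) ^+ 2).

Definition edge_length (p : quadruple R) (i j : 'I_4) : R :=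
  euclidean_dist (p i) (p j).

Definition longest_edge (p : quadruple R) (i j : 'I_4) : Prop :=
  i != j /\ forall k l, edge_length p k l <= edge_length p i j.

Definition replace_by_midpoint (p : quadruple R) (i j : 'I_4) : quadruple R :=
  [ffun k => if k == i then 2^-1 *: (p i + p j) else p k].

Definition bisection_child (i j : 'I_4) (D D' : labeled_tetrahedron R) : Prop :=
  vertex D' = replace_by_midpoint D i j \/ vertex D' = replace_by_midpoint D j i.

Definition LEB_branch (D : labeled_tetrahedron R)
    (b : nat -> labeled_tetrahedron R) : Prop :=
  b 0%N = D /\
  forall n, exists i j,
    longest_edge (b n) i j /\ bisection_child i j (b n) (b n.+1).

Definition refinement_tree (D : labeled_tetrahedron R) :
    set (labeled_tetrahedron R) :=
  [set D' | exists b, LEB_branch D b /\ exists n, b n = D'].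

Definition unique_longest_edge (p : quadruple R) : Prop :=
  exists! e : 'I_4 * 'I_4, (e.1 < e.2)%N /\ longest_edge p e.1 e.2.

Definition tie_free (D : labeled_tetrahedron R) : Prop :=
  forall D', refinement_tree D D' -> unique_longest_edge D'.

End Bisection.

(* Main.v *)
(** A sequence of bisections and relabellings acts on Gram matrices by a congruence
G |-> C^T G C with C rational.  There is a word of nine bisections for which C is a
multiple of a matrix A of determinant 1 that preserves a positive definite form
G0 and rotates a plane by an angle theta with 2 cos theta = 1/2; this is not an
algebraic integer, so the rotation has infinite order.  Started at G0, the word
always bisects an edge that beats all the others by a factor 10/9 in squared
length.  The Loewner balls (1 - e) G0 <= G <= (1 + e) G0 are invariant under the
congruence by A, so for small e every shape in such a ball can follow the word
periodically for ever, remains in a compact set, and visits infinitely many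
classes unless its component in the rotated plane vanishes.

Every tetrahedron of a refinement tree has squared edge lengths that are rational
linear forms in the six coordinates of the initial Gram matrix, distinct for
distinct edges.  Hence ties only occur on a countable union of hyperplanes. *)
Require Import Defs.
From mathcomp Require Import all_boot all_order all_algebra all_fingroup.
From mathcomp Require Import all_classical all_reals all_analysis measurable_realfun.
From mathcomp Require Import ring lra zify.

Set Implicit Arguments.
Unset Strict Implicit.
Unset Printing Implicit Defensive.

Import Order.TTheory GRing.Theory Num.Theory.
Import numFieldNormedType.Exports.

Local Open Scope classical_set_scope.
Local Open Scope ring_scope.
Local Open Scope quotient_scope.

(** * Bisection as a linear map of a reference simplex *)

Section ReferenceSimplex.
Context {F : fieldType}.

(** Vertex 0 is the origin and vertex k + 1 the k-th basis vector; [edge_mx p] carries this simplex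
    to p translated by - p_0. *)
Definition ref_vertex (m : 'I_4) : 'cV[F]_3 := \col_k (m == lift ord0 k)%:R.

Definition ref_edge (k l : 'I_4) : 'cV[F]_3 := ref_vertex k - ref_vertex l.

(* Vertex k of the reference simplex after vertex i has been moved to
   a p_i + (1 - a) p_j; bisection is a = 1/2, and a = 2 undoes it. *)
Definition slide_vertex (a : F) (i j k : 'I_4) : 'cV[F]_3 :=
  if k == i then a *: ref_vertex i + (1 - a) *: ref_vertex j else ref_vertex k.

(** Linear part of the affine map that sends each reference vertex m to [slide_vertex a i j m]. *)
Definition slide_mx (a : F) (i j : 'I_4) : 'M[F]_3 :=
  \matrix_(k, l) (slide_vertex a i j (lift ord0 l) - slide_vertex a i j ord0) k 0.

Lemma sum_ref_vertex (f : 'I_4 -> F) (m : 'I_4) : f ord0 = 0 ->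
  \sum_l f (lift ord0 l) * ref_vertex m l 0 = f m.
Proof.
move=> f0; transitivity (\sum_(k < 4) f k * (m == k)%:R).
  by rewrite [RHS]big_ord_recl f0 mul0r add0r; apply: eq_bigr => l _; rewrite mxE.
rewrite (bigD1 m)//= eqxx mulr1 big1 ?addr0// => k.
by rewrite eq_sym => /negbTE ->; rewrite mulr0.
Qed.

Lemma slide_mx_ref (a : F) (i j m : 'I_4) :
  slide_mx a i j *m ref_vertex m = slide_vertex a i j m - slide_vertex a i j ord0.
Proof.
apply/colP => k; rewrite mxE.
rewrite -(@sum_ref_vertex (fun m => (slide_vertex a i j m - slide_vertex a i j ord0) k 0)).
  by apply: eq_bigr => l _; rewrite [slide_mx _ _ _ _ _]mxE.
by rewrite subrr mxE.
Qed.

Lemma mulmx_slide_ref (n : nat) (X : 'M[F]_(n, 3)) (a : F) (i j : 'I_4) :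
  X *m slide_mx a i j =
  \matrix_(k, l) (X *m slide_vertex a i j (lift ord0 l)
                  - X *m slide_vertex a i j ord0) k 0.
Proof.
apply/matrixP => k l; rewrite [RHS]mxE -mulmxBr !mxE.
by apply: eq_bigr => m _; congr (_ * _); rewrite mxE.
Qed.

(** The slide fixes vertex j and multiplies the vector from j to i by a, so factors multiply under
    composition. *)
Lemma slide_mxM (a b : F) (i j : 'I_4) : i != j ->
  slide_mx a i j *m slide_mx b i j = slide_mx (a * b) i j.
Proof.
move=> ij; rewrite mulmx_slide_ref; apply/matrixP => k l; rewrite [LHS]mxE [RHS]mxE.
have E m : slide_mx a i j *m slide_vertex b i j m =
    slide_vertex (a * b) i j m - slide_vertex a i j ord0.
  rewrite {1}/slide_vertex; case: eqP => [->|/eqP mi].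
    rewrite mulmxDr -!scalemxAr !slide_mx_ref /slide_vertex eqxx.
    rewrite [j == i]eq_sym (negbTE ij); case: ifP => _;
      apply/colP => h; rewrite !mxE; ring.
  by rewrite slide_mx_ref /slide_vertex (negbTE mi).
rewrite !E !mxE; ring.
Qed.

Lemma slide_mx1 (i j : 'I_4) : slide_mx 1 i j = 1%:M.
Proof.
have E m : slide_vertex 1 i j m = ref_vertex m.
  by rewrite /slide_vertex; case: eqP => // ->; rewrite subrr scale0r addr0 scale1r.
apply/matrixP => k l; rewrite mxE !E !mxE (inj_eq lift_inj) eq_sym.
by rewrite (negbTE (neq_lift _ _)) subr0.
Qed.

Lemma slide_mx_unit (a : F) (i j : 'I_4) : i != j -> a != 0 ->
  slide_mx a i j \in unitmx.
Proof.
move=> ij a0; apply: (@mulmx1_unit _ _ _ (slide_mx a^-1 i j) _).1.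
by rewrite slide_mxM// mulfV// slide_mx1.
Qed.

End ReferenceSimplex.

Lemma map_ref_vertex (F K : fieldType) (f : {rmorphism F -> K}) (m : 'I_4) :
  map_mx f (ref_vertex m) = ref_vertex m.
Proof. by apply/matrixP => k l; rewrite !mxE rmorph_nat. Qed.

(** Bisection matrices thus come from rational ones, which makes rational independence pass to
    children. *)
Lemma map_slide_mx (F K : fieldType) (f : {rmorphism F -> K}) (a : F) (i j : 'I_4) :
  map_mx f (slide_mx a i j) = slide_mx (f a) i j.
Proof.
have E m k : f (slide_vertex a i j m k 0) = slide_vertex (f a) i j m k 0.
  rewrite /slide_vertex; case: eqP => _; rewrite !mxE ?rmorph_nat//.
  by rewrite rmorphD !rmorphM rmorphB rmorph1 !rmorph_nat.
by apply/matrixP => k l; rewrite !mxE rmorphB !E.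
Qed.

(** * Bisection and relabelling as congruences of Gram matrices *)

Section Gram.
Context {R : realType}.
Implicit Types (p : quadruple R) (D : labeled_tetrahedron R) (G H : 'M[R]_3).

Definition quad_form G (x : 'cV[R]_3) : R := (x^T *m G *m x) 0 0.

Lemma quad_form_congr G (A : 'M[R]_3) x :
  quad_form (A^T *m G *m A) x = quad_form G (A *m x).
Proof. by rewrite /quad_form trmx_mul !mulmxA. Qed.

Lemma quad_formZ c G x : quad_form (c *: G) x = c * quad_form G x.
Proof. by rewrite /quad_form -scalemxAr -scalemxAl mxE. Qed.

Lemma edge_mx_ref p m : edge_mx p *m ref_vertex m = p m - p ord0.
Proof.
apply/colP => k; rewrite mxE -(@sum_ref_vertex _ (fun m => (p m - p ord0) k 0)).
  by apply: eq_bigr => l _; rewrite [edge_mx _ _ _]mxE.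
by rewrite subrr mxE.
Qed.

Lemma edge_mx_replace_by_midpoint p i j :
  edge_mx (replace_by_midpoint p i j) = edge_mx p *m slide_mx 2^-1 i j.
Proof.
have half : 1 - 2^-1 = 2^-1 :> R by field.
rewrite mulmx_slide_ref; apply/matrixP => k l; rewrite [LHS]mxE [RHS]mxE !ffunE.
have E m : edge_mx p *m slide_vertex 2^-1 i j m =
    (if m == i then 2^-1 *: (p i + p j) else p m) - p ord0.
  rewrite /slide_vertex; case: eqP => _; last exact: edge_mx_ref.
  rewrite mulmxDr -!scalemxAr !edge_mx_ref half.
  by apply/colP => h; rewrite !mxE; field.
by rewrite !E; congr (_ k 0); rewrite opprB addrA subrK.
Qed.

Lemma gram_replace_by_midpoint p i j :
  gram (replace_by_midpoint p i j) =
  (slide_mx 2^-1 i j)^T *m gram p *m slide_mx 2^-1 i j.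
Proof. by rewrite /gram edge_mx_replace_by_midpoint trmx_mul !mulmxA. Qed.

Lemma edge_lengthE p k l :
  edge_length p k l = Num.sqrt (quad_form (gram p) (ref_edge k l)).
Proof.
rewrite /edge_length /euclidean_dist /gram -[(edge_mx p)^T]mulmx1 quad_form_congr.
rewrite mulmxBr !edge_mx_ref /quad_form mulmx1 opprB addrA subrK mxE.
by congr Num.sqrt; apply: eq_bigr => m _; rewrite !mxE expr2.
Qed.

Lemma posdef_unit (M A : 'M[R]_3) : A \in unitmx -> posdef R M ->
  posdef R (A^T *m M *m A).
Proof.
move=> Au Mp; apply: posdef_congr Mp _ => x; apply: contra => /eqP Ax.
by rewrite -[x]mul1mx -(mulVmx Au) -mulmxA Ax mulmx0.
Qed.

Lemma affinely_independentE p : affinely_independent p = (edge_mx p \in unitmx).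
Proof.
apply/idP/idP => [ip|pu].
  rewrite -unitmx_tr -row_free_unit; apply: inj_row_free => v vp.
  apply/eqP; apply: contraT => v0.
  have := @edge_mx_inj _ (LabeledTetrahedron ip) v^T.
  rewrite trmx_eq0 /= => /(_ v0)/eqP[].
  by rewrite -[edge_mx p]trmxK -trmx_mul vp trmx0.
apply/freeP => k pk0 i.
suff /(congr1 (fun x : 'cV[R]_3 => x i 0)) : \col_i k i = 0 by rewrite !mxE.
rewrite -[LHS]mul1mx -(mulVmx pu) -mulmxA -[RHS](mulmx0 _ (invmx (edge_mx p))).
congr (_ *m _); apply/colP => h; rewrite -[in RHS]pk0 mxE summxE.
by apply: eq_bigr => l _; rewrite (nth_map ord0) ?size_enum_ord// nth_ord_enum !mxE mulrC.
Qed.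

Lemma edge_mx_unit D : edge_mx D \in unitmx.
Proof. by rewrite -affinely_independentE vertex_affinely_independent. Qed.

Lemma perm_coord_ref (s : 'S_4) m :
  perm_coord s *m ref_vertex m = ref_vertex (s m) - ref_vertex (s ord0) :> 'cV[R]_3.
Proof.
apply/colP => k.
rewrite mxE -(@sum_ref_vertex _ (fun m => (ref_vertex (s m) - ref_vertex (s ord0)) k 0)).
  by apply: eq_bigr => l _; rewrite !mxE.
by rewrite subrr mxE.
Qed.

Lemma perm_coord_unit (s : 'S_4) : (perm_coord s : 'M[R]_3) \in unitmx.
Proof.
by apply: (@mulmx1_unit _ _ _ (perm_coord s^-1) _).1;
  rewrite -perm_coordM mulVg perm_coord1.
Qed.

Lemma perm_coord_edge (s : 'S_4) k l :
  perm_coord s *m ref_edge k l = ref_edge (s k) (s l) :> 'cV[R]_3.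
Proof. by rewrite mulmxBr !perm_coord_ref opprB addrA subrK. Qed.

(** Relabelling carries a slide along ij to the slide along the relabelled edge, so the word can be
    followed in any labelling of a shape. *)
Lemma perm_coord_slide (s : 'S_4) (a : R) i j :
  perm_coord s *m slide_mx a i j = slide_mx a (s i) (s j) *m perm_coord s.
Proof.
have E m : perm_coord s *m slide_vertex a i j m =
    slide_vertex a (s i) (s j) (s m) - ref_vertex (s ord0).
  rewrite /slide_vertex (inj_eq perm_inj); case: eqP => _; last exact: perm_coord_ref.
  rewrite mulmxDr -!scalemxAr !perm_coord_ref.
  by apply/colP => h; rewrite !mxE; ring.
rewrite mulmx_slide_ref; apply/matrixP => k l; rewrite [LHS]mxE !E.
transitivity ((slide_mx a (s i) (s j) *m
    (ref_vertex (s (lift ord0 l)) - ref_vertex (s ord0))) k 0).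
  by rewrite mulmxBr !slide_mx_ref !mxE; ring.
by rewrite [LHS]mxE [RHS]mxE; apply: eq_bigr => h _; rewrite !mxE.
Qed.

(** Flattens the two successive quotients, by scaling and by relabelling, into one condition on
    matrices. *)
Lemma gram_classP (G H : posdef R) : gram_class G = gram_class H <->
  exists s, exists2 c, 0 < c &
    \val H = c *: ((perm_coord s)^T *m \val G *m perm_coord s).
Proof.
split=> [/eqquotP/existsP[s /eqP]|[s [c c0 E]]].
  by rewrite perm_labeledE => /esym/labeled_classP[c c0 E]; exists s, c.
apply/eqquotP/existsP; exists s; apply/eqP; rewrite perm_labeledE.
by apply/esym/labeled_classP; exists c.
Qed.

(** Lifts a bisection from shapes to tetrahedra. D matches G only up to a relabelling s and a
    scalar, so the edge bisected in D is the preimage of ij under s; being longest is unaffected by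
    both. *)
Lemma bisection_shape D (G G' : posdef R) i j :
  tetra_shape D = gram_class G -> i != j ->
  (forall k l, quad_form (\val G) (ref_edge k l) <=
               quad_form (\val G) (ref_edge i j)) ->
  \val G' = (slide_mx 2^-1 i j)^T *m \val G *m slide_mx 2^-1 i j ->
  exists2 D', tetra_shape D' = gram_class G' &
    exists k l, longest_edge D k l /\ bisection_child k l D D'.
Proof.
move=> /esym/gram_classP[s [c c0 /= gD]] ij Gij G'E.
set i' := (s^-1)%g i; set j' := (s^-1)%g j.
have [si sj] : s i' = i /\ s j' = j by rewrite /i' /j' !permKV.
have ij' : i' != j' by rewrite (inj_eq perm_inj).
have iD : affinely_independent (replace_by_midpoint D i' j').
  rewrite affinely_independentE edge_mx_replace_by_midpoint unitmx_mul edge_mx_unit.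
  by rewrite slide_mx_unit// invr_neq0// pnatr_eq0.
exists (LabeledTetrahedron iD).
  apply/esym/gram_classP; exists s, c => //=.
  rewrite gram_replace_by_midpoint gD G'E -scalemxAr -scalemxAl; congr (_ *: _).
  transitivity ((perm_coord s *m slide_mx 2^-1 i' j')^T *m \val G *m
      (perm_coord s *m slide_mx 2^-1 i' j')); first by rewrite trmx_mul !mulmxA.
  by rewrite perm_coord_slide si sj trmx_mul !mulmxA.
exists i', j'; split; last by left.
split=> // k l; rewrite !edge_lengthE gD !quad_formZ !quad_form_congr.
by rewrite !perm_coord_edge si sj ler_wsqrtr// ler_pM2l.
Qed.

End Gram.

(** * Rational independence of the Gram coordinates excludes ties *)

Section Generic.
Context {R : realType}.
Implicit Types (D : labeled_tetrahedron R) (G : 'M[R]_3).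

(* For symmetric G: the six coordinates of G are linearly independent over the
   rationals. *)
Definition rationally_independent G := forall S : 'M[rat]_3,
  S^T = S -> \tr (G *m map_mx ratr S) = 0 -> S = 0.

Lemma rationally_independentZ c G : c != 0 ->
  rationally_independent G -> rationally_independent (c *: G).
Proof.
move=> c0 gG S Ss; rewrite -scalemxAl mxtraceZ => /eqP.
by rewrite mulf_eq0 (negbTE c0) => /eqP; exact: gG.
Qed.

(** By cyclicity of the trace, a relation S for the new matrix is the relation W S W^T for G, and W
    is invertible. *)
Lemma rationally_independent_congr (W : 'M[rat]_3) G : W \in unitmx ->
  rationally_independent G ->
  rationally_independent ((map_mx ratr W)^T *m G *m map_mx ratr W).
Proof.
move=> Wu gG S Ss trS; have /gG : (W *m S *m W^T)^T = W *m S *m W^T.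
  by rewrite !trmx_mul trmxK Ss mulmxA.
rewrite !map_mxM -map_trmx !mulmxA mxtrace_mulC !mulmxA => /(_ trS) WSW.
rewrite -[S]mulmx1 -trmx1 -(mulVmx Wu) trmx_mul mulmxA -[S]mul1mx -(mulVmx Wu).
by rewrite -!mulmxA (mulmxA W) (mulmxA (W *m S)) WSW mul0mx mulmx0.
Qed.

Lemma rationally_independent_perm (s : 'S_4) G : rationally_independent G ->
  rationally_independent ((perm_coord s)^T *m G *m perm_coord s).
Proof.
pose W : 'M[rat]_3 := \matrix_(k, j) ((s (lift ord0 j) == lift ord0 k)%:R
                                      - (s ord0 == lift ord0 k)%:R).
have WE : map_mx ratr W = perm_coord s :> 'M[R]_3.
  by apply/matrixP => k j; rewrite !mxE rmorphB !rmorph_nat.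
rewrite -WE; apply: rationally_independent_congr.
by rewrite -(map_unitmx (@ratr R)) WE perm_coord_unit.
Qed.

Lemma rationally_independent_class (G H : posdef R) :
  gram_class G = gram_class H ->
  rationally_independent (\val G) -> rationally_independent (\val H).
Proof.
move=> /gram_classP[s [c c0 ->]] gG.
by apply: rationally_independentZ; rewrite ?gt_eqF//; exact: rationally_independent_perm.
Qed.

Lemma quad_form_tr G x : quad_form G x = \tr (G *m (x *m x^T)).
Proof. by rewrite mulmxA mxtrace_mulC mulmxA /mxtrace big_ord1. Qed.

(** The square of coordinate a records whether vertex a + 1 lies on the edge. An edge has exactly
    two vertices, so the three answers determine it. *)
Lemma ref_edge_sqr_inj (i j k l : 'I_4) : (i < j)%N -> (k < l)%N ->
  (forall a, (ref_edge i j : 'cV[rat]_3) a 0 ^+ 2 = (ref_edge k l : 'cV[rat]_3) a 0 ^+ 2) ->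
  (i, j) = (k, l).
Proof.
move=> ij kl E.
have sq (m n : 'I_4) a : (m < n)%N -> (ref_edge m n : 'cV[rat]_3) a 0 ^+ 2 =
    ((m == a.+1 :> nat) || (n == a.+1 :> nat))%:R.
  move=> mn; rewrite !mxE -!val_eqE /= /bump /= add1n.
  case: (eqVneq (m : nat) _) => [mE|_]; case: (eqVneq (n : nat) _) => [nE|_];
    rewrite ?subrr ?subr0 ?sub0r ?sqrrN ?expr1n ?expr0n//.
  by move: mn; rewrite mE nE ltnn.
have {}E (a : 'I_3) : (i == a.+1 :> nat) || (j == a.+1 :> nat) =
             (k == a.+1 :> nat) || (l == a.+1 :> nat) :> bool.
  by have := E a; rewrite !sq//; do 2 case: (_ || _).
have := E 0; have := E 1; have := E (inord 2); rewrite inordK//= => E2 E1 E0.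
move: ij kl E2 E1 E0 {E sq}; case: i => [[|[|[|[|//]]]] ?]; case: j => [[|[|[|[|//]]]] ?] //=;
  case: k => [[|[|[|[|//]]]] ?]; case: l => [[|[|[|[|//]]]] ?] //= *;
  by congr pair; apply: val_inj.
Qed.

(** With u and v the two edge vectors, equal lengths give the rational relation u u^T - v v^T.
    Independence makes it zero, and its diagonal already identifies the edges. *)
Lemma rationally_independent_edge_inj G (i j k l : 'I_4) :
  rationally_independent G -> (i < j)%N -> (k < l)%N ->
  quad_form G (ref_edge i j) = quad_form G (ref_edge k l) -> (i, j) = (k, l).
Proof.
move=> gG ij kl; rewrite !quad_form_tr => /eqP; rewrite -subr_eq0 -raddfB -mulmxBr.
pose u : 'cV[rat]_3 := ref_edge i j; pose v : 'cV[rat]_3 := ref_edge k l.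
have mapE m n : ref_edge m n = map_mx ratr (ref_edge m n) :> 'cV[R]_3.
  by rewrite map_mxB !map_ref_vertex.
rewrite !mapE !map_trmx -!map_mxM -map_mxB => /eqP/gG S0; apply: ref_edge_sqr_inj => // a.
have diagE (x : 'cV[rat]_3) : (x *m x^T) a a = x a 0 ^+ 2 by rewrite mxE big_ord1 mxE.
rewrite -/u -/v -!diagE; congr (fun_of_matrix _ a a); apply/subr0_eq/S0.
by rewrite raddfB /= !trmx_mul !trmxK.
Qed.

Lemma edge_lengthC (p : quadruple R) k l : edge_length p k l = edge_length p l k.
Proof.
by rewrite /edge_length /euclidean_dist; congr Num.sqrt; apply: eq_bigr => m _;
  rewrite -sqrrN opprB.
Qed.

Lemma edge_length_refl (p : quadruple R) k : edge_length p k k = 0.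
Proof.
by rewrite /edge_length /euclidean_dist big1 ?sqrtr0// => m _; rewrite subrr expr0n.
Qed.

Lemma rationally_independent_unique_longest_edge (p : quadruple R) :
  rationally_independent (gram p) -> unique_longest_edge p.
Proof.
move=> gp; pose F (e : 'I_4 * 'I_4) := edge_length p e.1 e.2.
pose e0 : 'I_4 * 'I_4 := (ord0, ord_max).
have e0P : (e0.1 < e0.2)%N by [].
case: (@Order.TotalTheory.arg_maxP _ _ _ e0 (fun e => (e.1 < e.2)%N) F e0P) => e e12 Fe.
have eL k l : edge_length p k l <= F e.
  case: (ltngtP k l) => [kl|lk|/val_inj ->].
  - exact: (Fe (k, l)).
  - by rewrite edge_lengthC; exact: (Fe (l, k)).
  - by rewrite edge_length_refl sqrtr_ge0.
exists e; split.
  by split=> //; split=> //; rewrite -val_eqE /= ltn_eqF.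
move=> e' [e'12 [_ e'L]].
have : F e = F e' by apply/le_anti; rewrite eL e'L.
have q0 k l : 0 <= quad_form (gram p) (ref_edge k l).
  rewrite /gram -[(edge_mx p)^T]mulmx1 quad_form_congr /quad_form mulmx1.
  exact: sqnorm_ge0.
rewrite /F !edge_lengthE => /(congr1 (fun x => x ^+ 2)); rewrite !sqr_sqrtr//.
by move/(rationally_independent_edge_inj gp e12 e'12); case: e {e12 Fe eL}; case: e' {e'12 e'L}.
Qed.

(** Each bisection is a congruence by an invertible rational matrix, so independence descends
    through the whole tree. *)
Lemma rationally_independent_tie_free D :
  rationally_independent (gram D) -> tie_free D.
Proof.
move=> gD D' [b [[b0 bS] [n <-]]]; apply: rationally_independent_unique_longest_edge.
elim: n => [|n IHn]; first by rewrite b0.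
have half : ratr 2^-1 = 2^-1 :> R by rewrite fmorphV rmorph_nat.
have child i j : i != j ->
    rationally_independent (gram (replace_by_midpoint (b n) i j)).
  move=> ij; rewrite gram_replace_by_midpoint -half -map_slide_mx.
  by apply: rationally_independent_congr => //; exact: slide_mx_unit.
have [i [j [[ij _] [->|->]]]] := bS n; first exact: child.
by apply: child; rewrite eq_sym.
Qed.

End Generic.

(** * Measure of hyperplanes and boxes in six dimensions *)

Section Hyperplanes.
Context {R : realType}.

Let leb : {sigma_finite_measure set (measurableTypeR R) -> \bar R} := @lebesgue_measure R.

Lemma measurable_fun_affine d (T : measurableType d) (f : T -> R) (s : R) :
  measurable_fun setT f -> measurable_fun setT (fun z : T * R => f z.1 + s * z.2).
Proof.
move=> mf; apply: measurable_funD.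
  exact: measurableT_comp mf measurable_fst.
exact: measurable_funM (measurable_cst _) measurable_snd.
Qed.

(** For s != 0 every section is a single point; for s = 0 the set is a cylinder over the zero set of
    f. *)
Lemma product_affine_null d (T : measurableType d) (m : {measure set T -> \bar R})
    (f : T -> R) (s : R) : measurable_fun setT f ->
  s != 0 \/ m (f @^-1` [set 0]) = 0%E ->
  (m \x leb)%E [set z | f z.1 + s * z.2 = 0] = 0%E.
Proof.
move=> mf; have [->|s0] := eqVneq s 0 => [[//|m0]|_].
  have -> : [set z | f z.1 + 0 * z.2 = 0] = (f @^-1` [set 0]) `*` setT :> set (T * R).
    by apply/seteqP; split => -[x y] /=; rewrite mul0r addr0 => // -[].
  rewrite product_measure1E ?m0 ?mul0e//.
  by rewrite -[X in measurable X]setTI; exact: mf.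
rewrite /product_measure1; apply: integral0_eq => x _ /=.
have -> : xsection [set z | f z.1 + s * z.2 = 0] x = [set - f x / s].
  apply/seteqP; split => y; rewrite /xsection /= ?inE /=.
    by move=> /eqP; rewrite addrC addr_eq0 => /eqP <-; rewrite mulrAC mulfV ?mul1r.
  by move=> ->; rewrite mulrCA mulfV// mulr1 subrr.
exact: lebesgue_measure_set1.
Qed.

Lemma affine_null (s : R) : s != 0 -> leb [set x | s * x = 0] = 0%E.
Proof.
move=> s0; have -> : [set x | s * x = 0] = [set 0].
  apply/seteqP; split => x /=; last by move=> ->; rewrite mulr0.
  by move/eqP; rewrite mulf_eq0 (negbTE s0) => /eqP.
exact: lebesgue_measure_set1.
Qed.

Definition linear_form6 (c z : R * R * R * R * R * R) : R :=
  let '(c1, c2, c3, c4, c5, c6) := c in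
  c1 * z.1.1.1.1.1 + c2 * z.1.1.1.1.2 + c3 * z.1.1.1.2 + c4 * z.1.1.2
  + c5 * z.1.2 + c6 * z.2.

Lemma measurable_linear_form6 c : measurable_fun setT (linear_form6 c).
Proof.
case: c => [[[[[c1 c2] c3] c4] c5] c6].
have mf := measurable_fun_affine.
have m1 : measurable_fun setT (fun x : measurableTypeR R => c1 * x : R).
  by apply: measurable_funM => //; exact: measurable_id.
exact: (mf _ _ _ c6 (mf _ _ _ c5 (mf _ _ _ c4 (mf _ _ _ c3 (mf _ _ _ c2 m1))))).
Qed.

Lemma hyperplane_null c : c != (0, 0, 0, 0, 0, 0) ->
  lebesgue6 [set z | linear_form6 c z = 0] = 0%E.
Proof.
case: c => [[[[[c1 c2] c3] c4] c5] c6] c0.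
have mf := measurable_fun_affine.
have m1 : measurable_fun setT (fun x : measurableTypeR R => c1 * x : R).
  by apply: measurable_funM => //; exact: measurable_id.
pose m2 := mf _ _ _ c2 m1; pose m3 := mf _ _ _ c3 m2.
pose m4 := mf _ _ _ c4 m3; pose m5 := mf _ _ _ c5 m4.
(* Coordinates are removed from the last one on: a nonzero coefficient ends the descent, a zero one
   passes to one variable fewer. *)
apply: (@product_affine_null _ _ (leb \x leb \x leb \x leb \x leb)%E _ c6 m5); have [c60|] := eqVneq c6 0; [right|by left].
apply: (@product_affine_null _ _ (leb \x leb \x leb \x leb)%E _ c5 m4); have [c50|] := eqVneq c5 0; [right|by left].
apply: (@product_affine_null _ _ (leb \x leb \x leb)%E _ c4 m3); have [c40|] := eqVneq c4 0; [right|by left].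
apply: (@product_affine_null _ _ (leb \x leb)%E _ c3 m2); have [c30|] := eqVneq c3 0; [right|by left].
apply: (@product_affine_null _ _ leb _ c2 m1); have [c20|] := eqVneq c2 0; [right|by left].
apply: affine_null; apply: contra c0 => /eqP ->.
by rewrite c60 c50 c40 c30 c20.
Qed.

Definition box6 (z : R * R * R * R * R * R) (r : R) : set (R * R * R * R * R * R) :=
  ball z.1.1.1.1.1 r `*` ball z.1.1.1.1.2 r `*` ball z.1.1.1.2 r `*`
  ball z.1.1.2 r `*` ball z.1.2 r `*` ball z.2 r.

Lemma measurable_box6 z r : measurable (box6 z r).
Proof. by do 5 (apply: measurableX; last exact: measurable_ball); exact: measurable_ball. Qed.

(** Used for density: a box cannot lie inside a null set. *)
Lemma lebesgue6_box_gt0 z r : 0 < r -> (0 < lebesgue6 (box6 z r))%E.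
Proof.
move=> r0; have ball_gt0 x : (0 < leb (ball x r))%E.
  by rewrite /leb /= lebesgue_measure_ball ?ltW// lte_fin pmulrn_rgt0.
have step d (T : measurableType d) (m : {measure set T -> \bar R}) (A : set T) (x : R) :
    measurable A -> (0 < m A)%E -> (0 < (m \x leb)%E (A `*` ball x r))%E.
  by move=> mA mA0; rewrite product_measure1E ?mule_gt0//; exact: measurable_ball.
have mb x : measurable (ball x r : set (measurableTypeR R)) by exact: measurable_ball.
apply: (step _ _ (leb \x leb \x leb \x leb \x leb)%E); first by do 4 apply: measurableX => //.
apply: (step _ _ (leb \x leb \x leb \x leb)%E); first by do 3 apply: measurableX => //.
apply: (step _ _ (leb \x leb \x leb)%E); first by do 2 apply: measurableX => //.
apply: (step _ _ (leb \x leb)%E); first by apply: measurableX.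
exact: (step _ _ leb _ _ (mb _) (ball_gt0 _)).
Qed.

End Hyperplanes.

(** * The null set of rationally dependent symmetric matrices *)

Section Null.
Context {R : realType}.

Definition mx3 {F : pzRingType} (a b c d e f g h i : F) : 'M[F]_3 :=
  \matrix_(k, l) (nth [::] [:: [:: a; b; c]; [:: d; e; f]; [:: g; h; i]] k)`_l.

Definition sym_mx {F : pzRingType} (z : F * F * F * F * F * F) : 'M[F]_3 :=
  let '(a, b, c, d, e, f) := z in mx3 a d e d b f e f c.

Let j0 : 'I_3 := inord 0.
Let j1 : 'I_3 := inord 1.
Let j2 : 'I_3 := inord 2.

Lemma ord3P (P : 'I_3 -> Prop) : P (inord 0) -> P (inord 1) -> P (inord 2) ->
  forall i, P i.
Proof.
move=> P0 P1 P2 i; rewrite -(inord_val i).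
by case: i => [[|[|[|//]]]].
Qed.

Lemma sum3 (V : nmodType) (F : 'I_3 -> V) :
  \sum_i F i = F (inord 0) + F (inord 1) + F (inord 2).
Proof.
rewrite !big_ord_recl big_ord0 addr0 addrA.
by congr (F _ + F _ + F _); apply/val_inj; rewrite /= inordK.
Qed.

Lemma mx3E {F : pzRingType} (M : 'M[F]_3) : M = mx3
  (M (inord 0) (inord 0)) (M (inord 0) (inord 1)) (M (inord 0) (inord 2))
  (M (inord 1) (inord 0)) (M (inord 1) (inord 1)) (M (inord 1) (inord 2))
  (M (inord 2) (inord 0)) (M (inord 2) (inord 1)) (M (inord 2) (inord 2)).
Proof. by apply/matrixP => i j; rewrite mxE; elim/ord3P: i; elim/ord3P: j; rewrite !inordK. Qed.

Lemma sym_mxE (M : 'M[R]_3) : M^T = M -> M = sym_mx (sym_coord M).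
Proof.
move=> Ms; have S k l : M k l = M l k by rewrite -[in LHS]Ms mxE.
by rewrite [LHS]mx3E /sym_mx /sym_coord /= (S j1 j0) (S j2 j0) (S j2 j1).
Qed.

Lemma sym_mx_tr (z : R * R * R * R * R * R) : (sym_mx z)^T = sym_mx z.
Proof.
case: z => [[[[[a b] c] d] e] f]; apply/matrixP => i j; rewrite !mxE.
by elim/ord3P: i; elim/ord3P: j; rewrite !inordK.
Qed.

Lemma sym_coordK (z : R * R * R * R * R * R) : sym_coord (sym_mx z) = z.
Proof.
by case: z => [[[[[a b] c] d] e] f]; rewrite /sym_coord /sym_mx !mxE !inordK.
Qed.

(* Off-diagonal entries of a symmetric matrix occur twice in a trace. *)
Definition trace_coef (N : 'M[R]_3) : R * R * R * R * R * R :=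
  let '(a, b, c, d, e, f) := sym_coord N in (a, b, c, 2 * d, 2 * e, 2 * f).

Lemma mxtrace_sym (M N : 'M[R]_3) : M^T = M -> N^T = N ->
  \tr (M *m N) = linear_form6 (trace_coef N) (sym_coord M).
Proof.
move=> Ms Ns; rewrite {1}(sym_mxE Ms) {1}(sym_mxE Ns) /trace_coef.
case: (sym_coord M) => [[[[[a b] c] d] e] f]; case: (sym_coord N) => [[[[[a' b'] c'] d'] e'] f'].
by rewrite /mxtrace sum3 !mxE !sum3 !mxE !inordK//= /linear_form6 /=; ring.
Qed.

(** Rational matrices are enumerated through [unpickle], so that this is a union over nat and
    countable subadditivity applies. *)
Definition dependent_locus : set (R * R * R * R * R * R) := \bigcup_n
  if unpickle n is Some Q then
    [set z | [/\ Q^T = Q :> 'M[rat]_3, Q != 0 &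
                 linear_form6 (trace_coef (map_mx ratr Q)) z = 0]]
  else set0.

Lemma dependent_locusP (M : 'M[R]_3) : M^T = M ->
  rationally_independent M <-> ~ dependent_locus (sym_coord M).
Proof.
move=> Ms; split=> [Mi [n _]|Mnd S Ss trS].
  case: unpickle => // S [Ss S0]; rewrite -mxtrace_sym ?map_trmx ?Ss//.
  by move=> /(Mi _ Ss) /eqP; exact/negP.
apply/eqP; apply: contra_notT Mnd => S0; exists (pickle S) => //.
by rewrite pickleK; split=> //; rewrite -mxtrace_sym ?map_trmx ?Ss.
Qed.

(** Each nonzero symmetric rational matrix contributes one hyperplane, proper because the
    coefficients vanish only for the zero matrix. *)
Lemma negligible_dependent_locus : (@lebesgue6 R).-negligible dependent_locus.
Proof.
pose leb : {sigma_finite_measure set (measurableTypeR R) -> \bar R} := @lebesgue_measure R.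
apply: (@negligible_bigcup _ _ _ (leb \x leb \x leb \x leb \x leb \x leb)%E) => n.
case: unpickle => [S|]; last exact: negligible_set0.
have [Ss|Ss] := pselect (S^T = S); last first.
  by rewrite (_ : [set _ | _] = set0); [exact: negligible_set0|
    apply/seteqP; split=> // z []].
have [->|S0] := eqVneq S 0.
  by rewrite (_ : [set _ | _] = set0); [exact: negligible_set0|
    apply/seteqP; split=> // z []].
exists [set z | linear_form6 (trace_coef (map_mx ratr S)) z = 0]; split; last by move=> z [].
  rewrite -[X in measurable X]setTI.
  exact: (measurable_linear_form6 _ measurableT (measurable_set1 0)).
apply: hyperplane_null; apply: contra S0 => /eqP cS.
rewrite -(map_mx_eq0 (@ratr R)) (sym_mxE (M := map_mx _ S)) ?map_trmx ?Ss//.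
move: cS; rewrite /trace_coef; case: sym_coord => [[[[[a b] c] d] e] f].
move=> [-> -> ->] /eqP; rewrite mulf_eq0 pnatr_eq0 => /eqP -> /eqP.
rewrite mulf_eq0 pnatr_eq0 => /eqP -> /eqP; rewrite mulf_eq0 pnatr_eq0 => /eqP ->.
apply/eqP/matrixP => i j; rewrite !mxE.
by elim/ord3P: i; elim/ord3P: j; rewrite !inordK.
Qed.

Lemma null_of_dependent (A : set (shape_space R)) :
  (forall G : posdef R, A (gram_class G) -> ~ rationally_independent (\val G)) -> null A.
Proof.
move=> AG; have [B [mB B0 dB]] := negligible_dependent_locus.
exists B; split=> //; apply: subset_trans dB => _ [G AGG <-].
by apply: contrapT => /(dependent_locusP (set_valP G).1).2; exact: AG.
Qed.

(** Otherwise a box around M, of positive measure, would lie in the null dependent locus. *)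
Lemma rationally_independent_dense (M : 'M[R]_3) (r : R) : M^T = M -> 0 < r ->
  exists N, [/\ N^T = N, rationally_independent N &
                forall i j, `|M i j - N i j| < r].
Proof.
move=> Ms r0; apply: contrapT => NN.
have [B [mB B0 dB]] := negligible_dependent_locus.
have BM : box6 (sym_coord M) r `<=` B.
  apply: subset_trans dB => z Mz; apply: contrapT => zd.
  apply: NN; exists (sym_mx z); split; first exact: sym_mx_tr.
    by apply/(dependent_locusP (sym_mx_tr z)); rewrite sym_coordK.
  rewrite {1}(sym_mxE Ms); case: z Mz {zd} => [[[[[a b] c] d] e] f].
  case: (sym_coord M) => [[[[[a' b'] c'] d'] e'] f'] [[[[[/= ? ?] ?] ?] ?] ?] i j.
  by rewrite !mxE; elim/ord3P: i; elim/ord3P: j; rewrite !inordK.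
pose leb : {sigma_finite_measure set (measurableTypeR R) -> \bar R} := @lebesgue_measure R.
have := lebesgue6_box_gt0 (sym_coord M) r0; rewrite ltNge => /negP; apply.
rewrite -B0; apply: (@le_measure _ _ _ (leb \x leb \x leb \x leb \x leb \x leb)%E) => //;
  rewrite inE//; exact: measurable_box6.
Qed.

End Null.

(** * The nine-letter word and its reference Gram matrices *)

Local Notation vtx k := (@Ordinal 4 k isT).

Section Word.
Context {R : realType}.
Implicit Types (G M N : 'M[R]_3) (x : 'cV[R]_3).

Lemma tr_mx3 (a b c d e f g h i : R) :
  (mx3 a b c d e f g h i)^T = mx3 a d g b e h c f i.
Proof. by apply/matrixP => [[[|[|[|//]]] ?]] [[|[|[|//]]] ?]; rewrite !mxE. Qed.

Lemma mulmx_mx3 (a b c d e f g h i a' b' c' d' e' f' g' h' i' : R) :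
  mx3 a b c d e f g h i *m mx3 a' b' c' d' e' f' g' h' i' =
  mx3 (a * a' + b * d' + c * g') (a * b' + b * e' + c * h') (a * c' + b * f' + c * i')
      (d * a' + e * d' + f * g') (d * b' + e * e' + f * h') (d * c' + e * f' + f * i')
      (g * a' + h * d' + i * g') (g * b' + h * e' + i * h') (g * c' + h * f' + i * i').
Proof.
by apply/matrixP => [[[|[|[|//]]] ?]] [[|[|[|//]]] ?];
  rewrite mxE !big_ord_recl big_ord0 addr0 addrA !mxE.
Qed.

(** Squared edge lengths from the Gram entries, by the law of cosines; rows and columns are
    vertices. *)
Definition sqdist (z : R * R * R * R * R * R) (k l : nat) : R :=
  let '(a, b, c, d, e, f) := z in
  nth 0 (nth [::] [:: [:: 0; a; b; c];
                      [:: a; 0; a + b - 2 * d; a + c - 2 * e];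
                      [:: b; a + b - 2 * d; 0; b + c - 2 * f];
                      [:: c; a + c - 2 * e; b + c - 2 * f; 0]] k) l.

Lemma quad_form_ref_edge z (k l : 'I_4) :
  quad_form (sym_mx z) (ref_edge k l) = sqdist z k l.
Proof.
case: z => [[[[[a b] c] d] e] f]; rewrite /quad_form mxE sum3 !mxE !sum3 !mxE.
rewrite !inordK//=.
by case: k => [[|[|[|[|//]]]] ?]; case: l => [[|[|[|[|//]]]] ?] /=;
  rewrite -?val_eqE /= /bump /= ?inordK//=; ring.
Qed.

(* Letters are pairs (moved vertex, kept vertex); the word was found by a
   computer search among words whose matrix has an irrational rotation part. *)
Definition word : seq ('I_4 * 'I_4) :=
  [:: (vtx 1, vtx 0); (vtx 2, vtx 0); (vtx 0, vtx 3);
      (vtx 3, vtx 2); (vtx 2, vtx 1); (vtx 3, vtx 1);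
      (vtx 1, vtx 0); (vtx 0, vtx 3); (vtx 1, vtx 2)].

(** The default is a genuine edge, so [letter_neq] holds for every n. *)
Definition letter n : 'I_4 * 'I_4 := nth (vtx 1, vtx 0) word n.

Definition word_mx n : 'M[R]_3 := slide_mx 2^-1 (letter n).1 (letter n).2.

(* Successive Gram matrices along the word, in the order of sym_coord, starting
   from the form that word and relabelling reproduce up to the factor 1/64. *)
Definition word_gram : seq (R * R * R * R * R * R) :=
  [:: (44, 20, 18, 13, 24, 12);
      (11, 20, 18, 13 / 2, 12, 12);
      (11, 5, 18, 13 / 4, 12, 6);
      (7 / 2, 7 / 2, 9 / 2, - (5 / 4), 3 / 2, - (3 / 2));
      (7 / 2, 7 / 2, 5 / 4, - (5 / 4), 1 / 8, 1);
      (7 / 2, 9 / 8, 5 / 4, 9 / 8, 1 / 8, 9 / 16);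
      (7 / 2, 9 / 8, 5 / 4, 9 / 8, 29 / 16, 27 / 32);
      (7 / 8, 9 / 8, 5 / 4, 9 / 16, 29 / 32, 27 / 32);
      (9 / 32, 19 / 32, 5 / 16, 0, 9 / 64, 7 / 64)].

Definition center n : R * R * R * R * R * R := nth (0, 0, 0, 0, 0, 0) word_gram n.

Lemma word_mxE :
  [/\ word_mx 0 = mx3 (1 / 2) 0 0 0 1 0 0 0 1,
      word_mx 1 = mx3 1 0 0 0 (1 / 2) 0 0 0 1,
      word_mx 2 = mx3 1 0 0 0 1 0 (- (1 / 2)) (- (1 / 2)) (1 / 2) &
      word_mx 3 = mx3 1 0 0 0 1 (1 / 2) 0 0 (1 / 2)] /\
  [/\ word_mx 4 = mx3 1 (1 / 2) 0 0 (1 / 2) 0 0 0 1,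
      word_mx 5 = mx3 1 0 (1 / 2) 0 1 0 0 0 (1 / 2),
      word_mx 6 = mx3 (1 / 2) 0 0 0 1 0 0 0 1,
      word_mx 7 = mx3 1 0 0 0 1 0 (- (1 / 2)) (- (1 / 2)) (1 / 2) &
      word_mx 8 = mx3 (1 / 2) 0 0 (1 / 2) 1 0 0 0 1].
Proof.
by split; split; apply/matrixP => [[[|[|[|//]]] ?]] [[|[|[|//]]] ?];
  rewrite !mxE /slide_vertex -?val_eqE /= /bump /= ?mxE -?val_eqE /= /bump /=; field.
Qed.

(** The ninth letter is left out here: it closes the cycle only after a relabelling, in
    [cycle_step]. *)
Lemma word_step n : (n < 8)%N ->
  (word_mx n)^T *m sym_mx (center n) *m word_mx n = sym_mx (center n.+1).
Proof.
have [[E0 E1 E2 E3] [E4 E5 E6 E7 _]] := word_mxE.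
by case: n => [|[|[|[|[|[|[|[|//]]]]]]]] _;
  rewrite ?(E0, E1, E2, E3, E4, E5, E6, E7) tr_mx3 !mulmx_mx3; congr mx3; field.
Qed.

(** A finite check. The factor 9/10 is the margin that makes the word valid on a neighbourhood. *)
Lemma center_longest n (k l : 'I_4) : (n < 9)%N ->
  let i := (letter n).1 in let j := (letter n).2 in
  sqdist (center n) k l <= 9 / 10 * sqdist (center n) i j \/
  (k, l) = (i, j) \/ (k, l) = (j, i).
Proof.
case: n => [|[|[|[|[|[|[|[|[|//]]]]]]]]] _;
case: k => [[|[|[|[|//]]]] ?]; case: l => [[|[|[|[|//]]]] ?];
  rewrite /letter /center /word /word_gram /=;
  first [by left; lra | by right; left; congr pair; apply: val_inj
        | by right; right; congr pair; apply: val_inj].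
Qed.

End Word.

(** * Periodic repetition of the word *)

Section Orbit.
Context {R : realType}.
Implicit Types (G M N : 'M[R]_3) (x : 'cV[R]_3).

Lemma relabel_inj : injective (fun k : 'I_4 => nth (vtx 0) [:: (vtx 3); (vtx 2); (vtx 0); (vtx 1)] k).
Proof.
by move=> [[|[|[|[|//]]]] ?] [[|[|[|[|//]]]] ?] //= _; apply: val_inj.
Qed.

(** Applied after the ninth bisection, it brings the reference form back to 1/64 of itself, so that
    the word can start again. *)
Definition relabel : 'S_4 := perm relabel_inj.

Lemma relabel_mxE : perm_coord relabel = mx3 0 0 1 1 0 0 (- 1) (- 1) (- 1) :> 'M[R]_3.
Proof.
apply/matrixP => [[[|[|[|//]]] ?]] [[|[|[|//]]] ?];
  by rewrite !mxE !permE -?val_eqE /= ?subrr ?sub0r ?subr0.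
Qed.

Definition cycle_mx n : 'M[R]_3 :=
  if n == 8 then word_mx 8 *m perm_coord relabel else word_mx n.

Lemma cycle_step n : (n < 9)%N ->
  (cycle_mx n)^T *m sym_mx (center n) *m cycle_mx n =
  if n == 8 then 64^-1 *: sym_mx (center 0) else sym_mx (center n.+1).
Proof.
rewrite /cycle_mx leq_eqVlt eqSS => /orP[/eqP ->|n8].
  have [_ [_ _ _ _ ->]] := @word_mxE R; rewrite relabel_mxE eqxx mulmx_mx3 tr_mx3.
  rewrite !mulmx_mx3; apply/matrixP => [[[|[|[|//]]] ?]] [[|[|[|//]]] ?];
    by rewrite !mxE /=; field.
by rewrite ifF ?ltn_eqF// word_step.
Qed.

(** The matrix A of the cycle. It has eigenvalue 1, and its upper left block has trace 1/2 and
    determinant 1, hence is conjugate to a rotation with 2 cos theta = 1/2. *)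
Definition cycle_prod : 'M[R]_3 := mx3 0 1 0 (- 1) (1 / 2) 0 2 (- 1) 1.

Lemma cycle_prodE :
  cycle_mx 0 *m cycle_mx 1 *m cycle_mx 2 *m cycle_mx 3 *m cycle_mx 4 *m
  cycle_mx 5 *m cycle_mx 6 *m cycle_mx 7 *m cycle_mx 8 = - 8^-1 *: cycle_prod.
Proof.
have [[E0 E1 E2 E3] [E4 E5 E6 E7 E8]] := @word_mxE R.
rewrite /cycle_mx /= E0 E1 E2 E3 E4 E5 E6 E7 E8 relabel_mxE.
(* The last letter is merged with the relabelling; then the product is formed from the left, each
   partial product being reduced to numerals to keep the entries small. *)
rewrite [mx3 (1 / 2) 0 0 (1 / 2) 1 0 0 0 1 *m _](_ : _ =
  mx3 0 0 (1 / 2) 1 0 (1 / 2) (- 1) (- 1) (- 1)); last by rewrite mulmx_mx3; congr mx3; field.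
rewrite [mx3 (1 / 2) 0 0 0 1 0 0 0 1 *m _](_ : _ =
  mx3 (1 / 2) 0 0 0 (1 / 2) 0 0 0 1); last by rewrite mulmx_mx3; congr mx3; field.
rewrite [mx3 (1 / 2) 0 0 0 (1 / 2) 0 0 0 1 *m _](_ : _ =
  mx3 (1 / 2) 0 0 0 (1 / 2) 0 (- (1 / 2)) (- (1 / 2)) (1 / 2)); last by rewrite mulmx_mx3; congr mx3; field.
rewrite [mx3 (1 / 2) 0 0 0 (1 / 2) 0 (- (1 / 2)) (- (1 / 2)) (1 / 2) *m _](_ : _ =
  mx3 (1 / 2) 0 0 0 (1 / 2) (1 / 4) (- (1 / 2)) (- (1 / 2)) 0); last by rewrite mulmx_mx3; congr mx3; field.
rewrite [mx3 (1 / 2) 0 0 0 (1 / 2) (1 / 4) (- (1 / 2)) (- (1 / 2)) 0 *m _](_ : _ =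
  mx3 (1 / 2) (1 / 4) 0 0 (1 / 4) (1 / 4) (- (1 / 2)) (- (1 / 2)) 0); last by rewrite mulmx_mx3; congr mx3; field.
rewrite [mx3 (1 / 2) (1 / 4) 0 0 (1 / 4) (1 / 4) (- (1 / 2)) (- (1 / 2)) 0 *m _](_ : _ =
  mx3 (1 / 2) (1 / 4) (1 / 4) 0 (1 / 4) (1 / 8) (- (1 / 2)) (- (1 / 2)) (- (1 / 4))); last by rewrite mulmx_mx3; congr mx3; field.
rewrite [mx3 (1 / 2) (1 / 4) (1 / 4) 0 (1 / 4) (1 / 8) (- (1 / 2)) (- (1 / 2)) (- (1 / 4)) *m _](_ : _ =
  mx3 (1 / 4) (1 / 4) (1 / 4) 0 (1 / 4) (1 / 8) (- (1 / 4)) (- (1 / 2)) (- (1 / 4))); last by rewrite mulmx_mx3; congr mx3; field.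
rewrite [mx3 (1 / 4) (1 / 4) (1 / 4) 0 (1 / 4) (1 / 8) (- (1 / 4)) (- (1 / 2)) (- (1 / 4)) *m _](_ : _ =
  mx3 (1 / 8) (1 / 8) (1 / 8) (- (1 / 16)) (3 / 16) (1 / 16) (- (1 / 8)) (- (3 / 8)) (- (1 / 8))); last by rewrite mulmx_mx3; congr mx3; field.
rewrite mulmx_mx3; apply/matrixP => [[[|[|[|//]]] ?]] [[|[|[|//]]] ?];
  by rewrite !mxE /=; field.
Qed.

Lemma letter_neq n : (letter n).1 != (letter n).2.
Proof.
by case: (ltnP n 9) => [|n9]; [case: n => [|[|[|[|[|[|[|[|[|]]]]]]]]]|rewrite /letter nth_default].
Qed.

Lemma cycle_mx_unit n : cycle_mx n \in unitmx.
Proof.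
have wu m : word_mx m \in unitmx by rewrite slide_mx_unit ?letter_neq// invr_neq0// pnatr_eq0.
by rewrite /cycle_mx; case: ifP => _ //; rewrite unitmx_mul wu perm_coord_unit.
Qed.

Fixpoint gram_orbit G n := if n is m.+1 then
  (cycle_mx (m %% 9)%N)^T *m gram_orbit G m *m cycle_mx (m %% 9)%N else G.

Lemma gram_orbitZ c G n : gram_orbit (c *: G) n = c *: gram_orbit G n.
Proof. by elim: n => //= n ->; rewrite -scalemxAr -scalemxAl. Qed.

Lemma gram_orbit_posdef G n : posdef R G -> posdef R (gram_orbit G n).
Proof.
by move=> Gp; elim: n => //= n; exact: posdef_unit (cycle_mx_unit _).
Qed.

(** Nine steps compose to -1/8 times [cycle_prod], and a congruence squares the scalar. *)
Lemma gram_orbit_cycle G n : gram_orbit G (n + 9) = 64^-1 *: gram_orbit (cycle_prod^T *m G *m cycle_prod) n.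
Proof.
rewrite -gram_orbitZ; elim: n => [|n /= ->]; last by rewrite modnDr.
pose P := cycle_mx 0 *m cycle_mx 1 *m cycle_mx 2 *m cycle_mx 3 *m cycle_mx 4 *m
  cycle_mx 5 *m cycle_mx 6 *m cycle_mx 7 *m cycle_mx 8.
have S m : (m < 9)%N -> gram_orbit G m.+1 = (cycle_mx m)^T *m gram_orbit G m *m cycle_mx m.
  by move=> m9; rewrite /= modn_small.
transitivity (P^T *m G *m P).
  rewrite add0n !S//; have -> : gram_orbit G 0 = G by [].
  rewrite /P; move: (cycle_mx 0) (cycle_mx 1) (cycle_mx 2) (cycle_mx 3) (cycle_mx 4)
    (cycle_mx 5) (cycle_mx 6) (cycle_mx 7) (cycle_mx 8) => *.
  by rewrite !trmx_mul !mulmxA.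
have trZ (a : R) (M : 'M[R]_3) : (a *: M)^T = a *: M^T by apply/matrixP => i j; rewrite !mxE.
rewrite /P cycle_prodE trZ -!scalemxAl -scalemxAr scalerA; congr (_ *: _).
by field.
Qed.

Lemma gram_orbit_center n :
  gram_orbit (sym_mx (center 0)) n = 64^-1 ^+ (n %/ 9)%N *: sym_mx (center (n %% 9)%N).
Proof.
elim: n => [|n IHn]; first by rewrite scale1r.
rewrite /= IHn -scalemxAr -scalemxAl cycle_step ?ltn_pmod//; case: eqP => n8.
  have -> : (n.+1 %/ 9 = (n %/ 9)%N.+1)%N by lia.
  have -> : (n.+1 %% 9 = 0)%N by lia.
  by rewrite scalerA exprSr.
have -> : (n.+1 %/ 9 = n %/ 9)%N by lia.
by have -> : (n.+1 %% 9 = (n %% 9)%N.+1)%N by lia.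
Qed.

(** Unlike entrywise bounds, these are preserved by every congruence applied to both matrices. *)
Definition loewner_close e M N := forall x,
  (1 - e) * quad_form N x <= quad_form M x <= (1 + e) * quad_form N x.

Lemma gram_orbit_close e M N n : loewner_close e M N -> loewner_close e (gram_orbit M n) (gram_orbit N n).
Proof. by move=> MN; elim: n => //= n IHn x; rewrite !quad_form_congr. Qed.

Lemma ref_edgeC G k l : quad_form G (ref_edge k l) = quad_form G (ref_edge l k).
Proof.
rewrite /quad_form -[ref_edge k l]opprK [- ref_edge k l]opprB -/(ref_edge l k).
have -> : (- ref_edge l k)^T = - (ref_edge l k)^T :> 'rV[R]_3.
  by apply/matrixP => i j; rewrite !mxE.
by rewrite !(mulNmx, mulmxN) opprK.
Qed.

(** The margin absorbs the perturbation: (1 + 1/100) 9/10 <= 1 - 1/100. *)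
Lemma gram_orbit_longest G n k l : loewner_close (1 / 100) G (sym_mx (center 0)) ->
  quad_form (gram_orbit G n) (ref_edge k l) <=
  quad_form (gram_orbit G n) (ref_edge (letter (n %% 9)%N).1 (letter (n %% 9)%N).2).
Proof.
move=> /(gram_orbit_close n) Gn.
have := @center_longest R _ k l (ltn_pmod n (isT : 0 < 9)%N).
set i := (letter _).1; set j := (letter _).2 => -[kl|[[-> ->]|[-> ->]]]; last 2 first.
- by [].
- by rewrite ref_edgeC.
have /andP[_ kl2] := Gn (ref_edge k l); have /andP[ij1 _] := Gn (ref_edge i j).
apply: (le_trans kl2); apply: le_trans ij1; rewrite gram_orbit_center !quad_formZ.
have c0 : 0 <= 64^-1 ^+ (n %/ 9)%N :> R by rewrite exprn_ge0// invr_ge0.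
(* The margin applied to the degenerate edge ii, of length 0, gives the sign. *)
have sq0 : 0 <= sqdist (center (n %% 9)%N) i j :> R.
  have := @center_longest R _ i i (ltn_pmod n (isT : 0 < 9)%N); rewrite -/i -/j.
  have -> : sqdist (center (n %% 9)%N) i i = 0 :> R.
    by rewrite -quad_form_ref_edge /ref_edge subrr /quad_form mulmx0 mxE.
  have ij := letter_neq (n %% 9)%N.
  by case=> [?|[[ijE]|[ijE]]]; [lra|move: ij; rewrite -/i -/j ijE eqxx..].
rewrite !quad_form_ref_edge mulrCA [leRHS]mulrCA ler_wpM2l//; lra.
Qed.

End Orbit.

(** * Entrywise neighbourhoods compared with Loewner balls *)

Section Neighborhood.
Context {R : realType}.
Implicit Types (G M N : 'M[R]_3) (x : 'cV[R]_3) (r : R).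

Definition word_center : 'M[R]_3 := sym_mx (center 0).

Lemma word_center_tr : word_center^T = word_center.
Proof. exact: sym_mx_tr. Qed.

Definition near_center r M : Prop := forall i j, `|M i j - word_center i j| <= r.

Lemma quad_form3 M x : quad_form M x =
  \sum_i \sum_j M i j * (x i 0 * x j 0).
Proof.
rewrite /quad_form mxE exchange_big; apply: eq_bigr => j _.
rewrite mxE big_distrl; apply: eq_bigr => i _; rewrite mxE /=; ring.
Qed.

(** Each entry contributes at most r (x_i^2 + x_j^2) / 2; the factor 3 is the dimension. *)
Lemma quad_form_near r M x : near_center r M ->
  `|quad_form M x - quad_form word_center x| <= 3 * r * (\sum_i x i 0 ^+ 2).
Proof.
move=> Mr; rewrite !quad_form3 -sumrB.
apply: (@le_trans _ _ (\sum_i \sum_j r * ((x i 0 ^+ 2 + x j 0 ^+ 2) / 2))).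
  apply: (le_trans (ler_norm_sum _ _ _)); apply: ler_sum => i _.
  rewrite -sumrB; apply: (le_trans (ler_norm_sum _ _ _)); apply: ler_sum => j _.
  rewrite -mulrBl normrM ler_pM//.
  rewrite ler_norml; apply/andP; split.
    by have := sqr_ge0 (x i 0 + x j 0); nra.
  by have := sqr_ge0 (x i 0 - x j 0); nra.
by rewrite !sum3; lra.
Qed.

(* 5/2 is just below the least eigenvalue of word_center; completing squares in
   word_center - 5/2 gives the linear forms below. *)
Lemma word_center_ge x : 5 / 2 * (\sum_i x i 0 ^+ 2) <= quad_form word_center x.
Proof.
rewrite quad_form3 !sum3 /word_center /center /= !mxE !inordK//=.
set a := x _ _; set b := x _ _; set c := x _ _.
have := sqr_ge0 (83 * a + 26 * b + 48 * c); have := sqr_ge0 (2229 * b + 744 * c).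
by have := sqr_ge0 c; rewrite !expr2; lra.
Qed.

Lemma sum_sqr_ge0 x : 0 <= \sum_i x i 0 ^+ 2.
Proof. by apply: sumr_ge0 => i _; exact: sqr_ge0. Qed.

Lemma near_center_close r e M : 0 <= r -> 3 * r <= e * (5 / 2) ->
  near_center r M -> loewner_close e M word_center.
Proof.
move=> r0 re Mr x; have := quad_form_near x Mr; rewrite ler_norml => /andP[l u].
have := word_center_ge x; have := sum_sqr_ge0 x.
set s := \sum_i _ in l u *; set q := quad_form word_center x in l u * => s0 sq.
have e0 : 0 <= e by lra.
have rs : 3 * r * s <= e * q.
  apply: (@le_trans _ _ (e * (5 / 2) * s)); first by rewrite ler_wpM2r.
  by rewrite -mulrA ler_wpM2l.
by apply/andP; split; lra.
Qed.

(** The error 3/2 stays below the eigenvalue bound 5/2. *)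
Lemma near_center_posdef M : M^T = M -> near_center (1 / 2) M -> posdef R M.
Proof.
move=> Ms Mr; split=> // x x0; rewrite -/(quad_form M x).
have := quad_form_near x Mr; rewrite ler_norml => /andP[l _].
have := word_center_ge x; suff : 0 < \sum_i x i 0 ^+ 2 by lra.
have := sqnorm_gt0 x0; rewrite mxE; congr (0 < _).
by apply: eq_bigr => i _; rewrite mxE expr2.
Qed.

Lemma quad_form_delta M (i j : 'I_3) (s : R) :
  quad_form M (delta_mx i 0 + s *: delta_mx j 0) =
  M i i + s ^+ 2 * M j j + s * (M i j + M j i).
Proof.
have E k l : ((delta_mx k 0 : 'cV[R]_3)^T *m M *m (delta_mx l 0 : 'cV[R]_3)) 0 0 = M k l.
  by rewrite trmx_delta -rowE -colE !mxE.
rewrite -[M i i]E -[M i j]E -[M j i]E -[M j j]E /quad_form.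
have -> : (delta_mx i 0 + s *: delta_mx j 0 : 'cV[R]_3)^T =
    (delta_mx i 0)^T + s *: (delta_mx j 0)^T.
  by apply/matrixP => k l; rewrite !mxE.
rewrite !mulmxDl !mulmxDr -!scalemxAl -!scalemxAr.
move: (_ *m M *m _) (_ *m M *m _) (_ *m M *m _) (_ *m M *m _) => A B C D.
rewrite !mxE; ring.
Qed.

(** Polarization at e_i + e_j and e_i - e_j. Diagonal entries of the center are at most 44, so the
    error is at most 44/100 < 1/2. *)
Lemma close_near_center M : M^T = M -> loewner_close (1 / 100) M word_center ->
  near_center (1 / 2) M.
Proof.
move=> Ms Mc i j; have S : M j i = M i j by rewrite -[in LHS]Ms mxE.
have Hs : word_center j i = word_center i j by rewrite -[in LHS]word_center_tr mxE.
have H44 k : word_center k k <= 44.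
  by rewrite /word_center /center /= mxE; elim/ord3P: k; rewrite !inordK//=; lra.
have := Mc (delta_mx i 0 + 1 *: delta_mx j 0).
have := Mc (delta_mx i 0 + (- 1) *: delta_mx j 0).
rewrite !quad_form_delta S Hs sqrrN expr1n => /andP[? ?] /andP[? ?].
by have := H44 i; have := H44 j; rewrite ler_norml => ? ?; apply/andP; split; lra.
Qed.

End Neighborhood.

(** * Branches that follow the word, and compactness *)

Section Branch.
Context {R : realType}.

Definition orbit_gram (G : posdef R) n : posdef R :=
  SigSub (mem_set (gram_orbit_posdef n (set_valP G))).

Lemma orbit_gram_step (G : posdef R) n D :
  loewner_close (1 / 100) (\val G) word_center ->
  tetra_shape D = gram_class (orbit_gram G n) ->
  exists2 D', tetra_shape D' = gram_class (orbit_gram G n.+1) &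
    exists k l, longest_edge D k l /\ bisection_child k l D D'.
Proof.
move=> Gc DG; pose w : 'M[R]_3 := word_mx (n %% 9)%N.
have wu : w \in unitmx by rewrite slide_mx_unit ?letter_neq// invr_neq0// pnatr_eq0.
pose G1 : posdef R := SigSub (mem_set (posdef_unit wu (set_valP (orbit_gram G n)))).
have [|//|D' D'G step] := @bisection_shape _ _ _ G1 _ _ DG (letter_neq (n %% 9)%N).
  by move=> k l; exact: gram_orbit_longest.
exists D'; last exact: step.
rewrite D'G; apply/gram_classP; rewrite /= /cycle_mx -/w; case: eqP => n8; last first.
  by exists 1%g, 1; rewrite // perm_coord1 trmx1 mul1mx mulmx1 scale1r.
(* The relabelling after the ninth letter does not change the shape. *)
exists relabel, 1 => //; rewrite scale1r trmx_mul !mulmxA.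
by rewrite /w n8.
Qed.

Lemma orbit_branch (G : posdef R) D :
  loewner_close (1 / 100) (\val G) word_center -> tetra_shape D = gram_class G ->
  exists b, LEB_branch D b /\ forall n, tetra_shape (b n) = gram_class (orbit_gram G n).
Proof.
(* Dependent choice: each tetrahedron is bundled with a proof of its shape, from which the next step
   is obtained. *)
move=> Gc DG; pose T n := {D' | tetra_shape D' = gram_class (orbit_gram G n)}.
have D0 : tetra_shape D = gram_class (orbit_gram G 0).
  by rewrite DG; congr gram_class; apply: val_inj.
have next n (t : T n) : {t' : T n.+1 | exists k l,
    longest_edge (sval t) k l /\ bisection_child k l (sval t) (sval t')}.
  by have [D' D'G step] := cid2 (orbit_gram_step Gc (svalP t)); exists (exist _ D' D'G).
pose fix b n : T n := if n is m.+1 then sval (next m (b m)) else exist _ D D0.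
exists (fun n => sval (b n)); split; last by move=> n; exact: (svalP (b n)).
split=> // n; exact: (svalP (next n (b n))).
Qed.

Lemma continuous_mx (T : topologicalType) (m n : nat) (F : T -> 'M[R]_(m, n)) :
  (forall i j, continuous (fun z => F z i j)) -> continuous F.
Proof.
move=> cF z A [P Pz PA].
have Fz : \forall z' \near z, forall i j, P i j (F z' i j).
  by apply: filter_forall => i; apply: filter_forall => j; exact: (cF i j z _ (Pz i j)).
by apply: filterS Fz => z' Fz'; exact: PA.
Qed.

Lemma continuous_mulmx (m n p q : nat) (A : 'M[R]_(m, n)) (B : 'M[R]_(p, q)) :
  continuous (fun M : 'M[R]_(n, p) => A *m M *m B).
Proof.
apply: continuous_mx => i j.
have -> : (fun M => (A *m M *m B) i j) =
    (fun M : 'M[R]_(n, p) => \sum_k (\sum_l A i l * M l k) * B k j).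
  by apply/funext => M; rewrite mxE; apply: eq_bigr => k _; rewrite mxE.
apply: continuous_big => [|k _ M]; first exact: add_continuous.
apply: (continuous_comp _ (@mulrr_continuous _ (B k j) _)).
apply: (@continuous_big _ _ _ _ _ _ _ _ (fun l (M : 'M[R]_(n, p)) => A i l * M l k)) => [|l _ N].
  exact: add_continuous.
apply: (continuous_comp _ (@mulrl_continuous _ (A i l) _)).
exact: coord_continuous.
Qed.

Lemma continuous_gram_orbit n : continuous (fun M : 'M[R]_3 => gram_orbit M n).
Proof.
elim: n => [|n IHn] M /=; first exact: cvg_id.
exact: (continuous_comp (IHn M) (@continuous_mulmx _ _ _ _ _ _ _)).
Qed.

Lemma continuous_gram_class : continuous (@gram_class R).
Proof.
by move=> G; apply: continuous_comp; exact: pi_continuous.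
Qed.

Lemma continuous_orbit_gram n : continuous (fun G => orbit_gram G n).
Proof.
apply: continuous_comp_initial => G.
apply: (@continuous_comp _ _ _ set_val (fun M => gram_orbit M n)).
  exact: initial_continuous.
exact: continuous_gram_orbit.
Qed.

Lemma continuous_sym_mx :
  continuous (sym_mx : R * R * R * R * R * R -> 'M[R]_3).
Proof.
have p1 (T U : topologicalType) (V : topologicalType) (f : T -> V) :
    continuous f -> continuous (fun z : T * U => f z.1).
  by move=> cf z; apply: (continuous_comp _ (cf _)); exact: cvg_fst.
have p2 (T U : topologicalType) : continuous (fun z : T * U => z.2).
  by move=> z; exact: cvg_snd.
apply: continuous_mx => i j.
have -> : (fun z : R * R * R * R * R * R => sym_mx z i j) = fun z =>
    mx3 z.1.1.1.1.1 z.1.1.2 z.1.2 z.1.1.2 z.1.1.1.1.2 z.2 z.1.2 z.2 z.1.1.1.2 i j.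
  by apply/funext => -[[[[[a b] c] d] e] f].
under eq_fun do rewrite mxE.
have pf : continuous (fun z : R * R => z.1) by move=> z; exact: cvg_fst.
have c1 := p1 _ R _ _ (p1 _ R _ _ (p1 _ R _ _ (p1 _ R _ _ pf))).
have c2 := p1 _ R _ _ (p1 _ R _ _ (p1 _ R _ _ (p1 _ R _ _ (p2 R R)))).
have c3 := p1 _ R _ _ (p1 _ R _ _ (p1 _ R _ _ (p2 (R * R)%type R))).
have c4 := p1 _ R _ _ (p1 _ R _ _ (p2 (R * R * R)%type R)).
have c5 := p1 _ R _ _ (p2 (R * R * R * R)%type R).
have c6 := p2 (R * R * R * R * R)%type R.
by elim/ord3P: i; elim/ord3P: j; rewrite !inordK.
Qed.

Let segment6 : set (R * R * R * R * R * R) :=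
  let seg (x : R) := `[x - 1 / 2, x + 1 / 2]%classic in let z := center 0 in
  seg z.1.1.1.1.1 `*` seg z.1.1.1.1.2 `*` seg z.1.1.1.2 `*`
  seg z.1.1.2 `*` seg z.1.2 `*` seg z.2.

Let segment6P z : segment6 z <-> near_center (1 / 2) (sym_mx z).
Proof.
case: z => [[[[[a b] c] d] e] f]; rewrite /segment6 /near_center /word_center.
case: (center 0) => [[[[[a' b'] c'] d'] e'] f'] /=; rewrite !in_itv /=.
split=> [[[[[[]]]]] | near].
  move=> /andP[? ?] /andP[? ?] /andP[? ?] /andP[? ?] /andP[? ?] /andP[? ?] i j.
  rewrite !mxE ler_distl; elim/ord3P: i; elim/ord3P: j; rewrite !inordK//=; lra.
have := (near (inord 0) (inord 0), near (inord 1) (inord 1), near (inord 2) (inord 2),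
  near (inord 0) (inord 1), near (inord 0) (inord 2), near (inord 1) (inord 2)).
by rewrite !mxE !inordK//= !ler_distl => -[[[[[]]]]].
Qed.

Lemma compact_near_center :
  compact [set G : posdef R | near_center (1 / 2) (\val G)].
Proof.
have c0 : near_center (1 / 2) (word_center : 'M[R]_3).
  by move=> i j; rewrite subrr normr0; lra.
pose G0 : posdef R := SigSub (mem_set (near_center_posdef word_center_tr c0)).
(* A total section of the coordinates; the value [G0] is never taken on [segment6], where [g] agrees
   with [sym_mx]. *)
pose g z : posdef R := if pselect (posdef R (sym_mx z)) is left Gp
  then SigSub (mem_set Gp) else G0.
have gE z : segment6 z -> \val (g z) = sym_mx z.
  move=> /segment6P zc; rewrite /g; case: pselect => //= -[].
  exact: near_center_posdef (sym_mx_tr z) zc.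
have -> : [set G : posdef R | near_center (1 / 2) (\val G)] = g @` segment6.
  apply/seteqP; split=> [G Gc|_ [z zs <-]] /=; last by rewrite gE//; exact/segment6P.
  have GE := sym_mxE (set_valP G).1.
  have Gs : segment6 (sym_coord (\val G)) by apply/segment6P; rewrite -GE.
  by exists (sym_coord (\val G)) => //; apply: val_inj; rewrite gE.
apply: continuous_compact.
  have gc : {within segment6, continuous (fun z => \val (g z))}.
    apply: (@subspace_eq_continuous _ segment6 _ (sym_mx : _ -> 'M[R]_3)).
      by move=> z /set_mem /gE.
    exact: continuous_subspaceT continuous_sym_mx.
  exact: (@continuous_comp_initial _ _ _ _ (g : subspace segment6 -> posdef R) gc).
by do 5 (apply: compact_setX; last exact: segment_compact); exact: segment_compact.
Qed.

Lemma compact_orbit_class n :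
  compact ((fun G => gram_class (orbit_gram G n)) @`
    [set G | near_center (1 / 2) (\val G)]).
Proof.
apply: continuous_compact compact_near_center; apply: continuous_subspaceT => G.
exact: (continuous_comp (@continuous_orbit_gram n G) (@continuous_gram_class _)).
Qed.

End Branch.

(** * The induced rotation has infinite order *)

Section Rotation.
Context {R : realType}.
Implicit Types (M : 'M[R]_3) (z : R * R).

(** A linear map with characteristic polynomial X^2 - X/2 + 1, that is, a rotation by theta in
    suitable coordinates. *)
Definition rot z : R * R := (- z.2, z.1 + z.2 / 2).

(* rot^2 = rot / 2 - 1, so the coefficient of rot in 2^p rot^(p+1) stays odd. *)
Lemma iter_rotE z p : exists k m : int,
  2 ^+ p * (iter p.+1 rot z).1 = (2 * k + 1)%:~R * (rot z).1 + m%:~R * z.1 /\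
  2 ^+ p * (iter p.+1 rot z).2 = (2 * k + 1)%:~R * (rot z).2 + m%:~R * z.2.
Proof.
elim: p => [|p [k [m [E1 E2]]]].
  by exists 0, 0; rewrite mulr0 add0r !mul1r !mul0r !addr0.
exists (k + m), (- (2 * (2 * k + 1))); rewrite [iter p.+2 _ _]iterS exprS.
move: (iter p.+1 rot z) E1 E2 => w E1 E2; rewrite /= in E1 E2 *.
have -> : 2 * 2 ^+ p * - w.2 = - 2 * (2 ^+ p * w.2) by ring.
have -> : 2 * 2 ^+ p * (w.1 + w.2 / 2) = 2 * (2 ^+ p * w.1) + 2 ^+ p * w.2 by field.
by rewrite E1 E2 !(intrD, intrM, rmorphN) /=; split; field.
Qed.

(** A fixed z would satisfy n rot z = c z with n odd, hence nonzero, and [rot] has no real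
    eigenvalue. *)
Lemma iter_rot_neq z p : z != 0 -> iter p.+1 rot z != z.
Proof.
move=> z0; apply/eqP => zE; have [k [m]] := iter_rotE z p; rewrite zE /=.
set n : R := (_ + 1)%:~R; set c : R := 2 ^+ p - m%:~R => -[E1 E2].
have n0 : n != 0 by rewrite intr_eq0; apply/eqP; lia.
have {}E1 : c * z.1 = - n * z.2 by rewrite /c; lra.
have {}E2 : c * z.2 = n * (z.1 + z.2 / 2) by rewrite /c; lra.
(* This is n^2 times the characteristic polynomial of [rot] at c / n. *)
have pos : 0 < n ^+ 2 + c ^+ 2 - n * c / 2.
  have : 0 < n ^+ 2 by rewrite exprn_even_gt0.
  by have := sqr_ge0 (c - n / 4); nra.
have z2 : z.2 = 0.
  apply/eqP; have : (n ^+ 2 + c ^+ 2 - n * c / 2) * z.2 == 0.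
    have -> : (n ^+ 2 + c ^+ 2 - n * c / 2) * z.2 =
      n ^+ 2 * z.2 + c * (c * z.2) - n * c * z.2 / 2 by ring.
    rewrite E2 (_ : c * (n * (z.1 + z.2 / 2)) = n * (c * z.1) + n * c * z.2 / 2);
      last by ring.
    by rewrite E1; apply/eqP; ring.
  by rewrite mulf_eq0 gt_eqF.
move: E2; rewrite z2 mul0r mulr0 addr0 => /esym/eqP; rewrite mulf_eq0 (negbTE n0) /= => /eqP z1.
by case: z z1 z2 z0 {zE E1 pos} => x y /= -> ->; rewrite eqxx.
Qed.

(* cycle_prod acts on the last row of a Gram matrix, with fixed direction
   (4/3, 2/3, 1); relative to it the action is rot. *)
Definition tail_coord M : R * R :=
  (M (inord 2) (inord 0) / M (inord 2) (inord 2) - 4 / 3,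
   M (inord 2) (inord 1) / M (inord 2) (inord 2) - 2 / 3).

Lemma tail_coordZ c M : c != 0 -> tail_coord (c *: M) = tail_coord M.
Proof. by move=> c0; rewrite /tail_coord !mxE -!mulf_div divff// !mul1r. Qed.

Definition cycle_gram M : 'M[R]_3 := cycle_prod^T *m M *m cycle_prod.

(** The last column of [cycle_prod] is a basis vector, so the new last row depends only on the old
    one. *)
Lemma cycle_gram_tail M (j : 'I_3) : cycle_gram M (inord 2) j =
  \sum_k M (inord 2) k * cycle_prod k j.
Proof.
rewrite mxE; apply: eq_bigr => k _; congr (_ * _).
by rewrite mxE sum3 /cycle_prod !mxE !inordK//=; ring.
Qed.

Lemma cycle_gram22 M : cycle_gram M (inord 2) (inord 2) = M (inord 2) (inord 2).
Proof. by rewrite cycle_gram_tail sum3 /cycle_prod !mxE !inordK//=; ring. Qed.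

Lemma tail_coord_cycle M : M (inord 2) (inord 2) != 0 ->
  tail_coord (cycle_gram M) = rot (tail_coord M).
Proof.
move=> M0; rewrite /tail_coord cycle_gram22 /rot /= !cycle_gram_tail !sum3.
by rewrite /cycle_prod !mxE !inordK//=; congr pair; field.
Qed.

Lemma cycle_gram_center : cycle_gram word_center = word_center.
Proof.
by rewrite /cycle_gram /word_center /center /= tr_mx3 !mulmx_mx3; congr mx3; field.
Qed.

Lemma cycle_gram_close e M :
  loewner_close e M word_center -> loewner_close e (cycle_gram M) word_center.
Proof. by move=> Mc x; rewrite -cycle_gram_center !quad_form_congr. Qed.

Lemma cycle_prod_unit : (cycle_prod : 'M[R]_3) \in unitmx.
Proof.
apply: (@mulmx1_unit _ _ _ (mx3 (1 / 2) (- 1) 0 1 0 0 0 2 1) _).1.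
rewrite mulmx_mx3; apply/matrixP => [[[|[|[|//]]] ?]] [[|[|[|//]]] ?];
  by rewrite !mxE /=; field.
Qed.

Lemma iter_cycle_gram_posdef q M : posdef R M -> posdef R (iter q cycle_gram M).
Proof. by move=> Mp; elim: q => //= q; exact: posdef_unit cycle_prod_unit. Qed.

Lemma gram_orbit_iter q M n : gram_orbit M (n + q * 9) =
  64^-1 ^+ q *: gram_orbit (iter q cycle_gram M) n.
Proof.
elim: q M => [|q IHq] M; first by rewrite addn0 scale1r.
by rewrite mulSn addnCA addnC gram_orbit_cycle IHq scalerA exprS iterSr.
Qed.

End Rotation.

(** * Infinitely many classes, and the open set of shapes *)

Section Shapes.
Context {R : realType}.
Implicit Types M : 'M[R]_3.

Definition iter_gram (G : posdef R) q : posdef R :=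
  SigSub (mem_set (iter_cycle_gram_posdef q (set_valP G))).

(** Whole turns of the word can be performed first, at the cost of a scalar; only nine residues of
    the index then matter for compactness. *)
Lemma orbit_gram_class (G : posdef R) n q :
  gram_class (orbit_gram G (n + q * 9)) = gram_class (orbit_gram (iter_gram G q) n).
Proof.
apply/gram_classP; exists 1%g, (64 ^+ q); first by rewrite exprn_gt0.
rewrite perm_coord1 trmx1 mul1mx mulmx1 /= gram_orbit_iter scalerA -exprMn.
by rewrite divff// expr1n scale1r.
Qed.

Lemma posdef_diag_gt0 (M : 'M[R]_3) i : posdef R M -> 0 < M i i.
Proof.
move=> [_ /(_ (delta_mx i 0))]; rewrite -/(quad_form M _).
have := quad_form_delta M i i 0; rewrite scale0r addr0 => ->.
rewrite expr2 !mul0r !addr0; apply.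
by apply/eqP => /matrixP/(_ i 0)/eqP; rewrite !mxE !eqxx oner_eq0.
Qed.

Lemma tail_coord_iter (G : posdef R) q :
  tail_coord (\val (iter_gram G q)) = iter q rot (tail_coord (\val G)).
Proof.
elim: q => [|q IHq]; first by rewrite /=.
rewrite [RHS]iterS -IHq -tail_coord_cycle ?gt_eqF//.
exact: posdef_diag_gt0 (set_valP (iter_gram G q)).
Qed.

(** A class determines the Gram matrix up to scaling, which [tail_coord] ignores, and 24
    relabellings. Finitely many classes would thus allow finitely many tail coordinates, but the
    iterates of [rot] are all distinct. *)
Lemma infinite_orbit_class (G : posdef R) : tail_coord (\val G) != 0 ->
  infinite_set (range (fun n => gram_class (orbit_gram G n))).
Proof.
move=> G0 fin; set F := fun n => gram_class _ in fin.
pose rep (X : shape_space R) : posdef R := generic_quotient.repr (generic_quotient.repr X).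
have repK X : gram_class (rep X) = X by rewrite /gram_class /labeled_class !reprK.
pose phi (Xs : shape_space R * 'S_4) := tail_coord (\val (perm_gram Xs.2 (rep Xs.1))).
pose t q := iter q rot (tail_coord (\val G)).
have tfin : finite_set (range t).
  apply: sub_finite_set (finite_image phi (finite_setX fin (@finite_finset _ setT))).
  move=> _ [q _ <-]; rewrite /t -tail_coord_iter.
  have /gram_classP[s [c c0 E]] : gram_class (rep (F (q * 9)%N)) = gram_class (iter_gram G q).
    rewrite repK /F -[(q * 9)%N]add0n orbit_gram_class; congr gram_class; exact: val_inj.
  exists (F (q * 9)%N, s); first by split=> //; exists (q * 9)%N.
  by rewrite E tail_coordZ ?gt_eqF.
have t_inj : injective t.
  suff lt p q : (p < q)%N -> t p != t q.
    move=> p q tpq; case: (ltngtP p q) => // /lt; first by rewrite tpq eqxx.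
    by rewrite tpq eqxx.
  move=> pq; have -> : q = (p + (q - p).-1.+1)%N by lia.
  have rot_inj : injective (iter p (@rot R)).
    elim: p {pq} => [//|p IHp] x y /= rot_eq; apply: IHp; move: rot_eq.
    by case: (iter p _ x) (iter p _ y) => [a b] [c d] [] /oppr_inj -> /addIr ->.
  by rewrite /t iterD (inj_eq rot_inj) eq_sym iter_rot_neq.
have := infinite_nat; apply; move: tfin; rewrite (@eq_finite_set _ _ _ [set: nat])//.
by apply: inj_card_eq => p q _ _; exact: t_inj.
Qed.

(* The second condition keeps off the forms fixed by the cycle, whose branch would
   be periodic up to similarity. *)
Definition branch_mx : set 'M[R]_3 := [set M |
  (forall i j, `|M i j - word_center i j| < 1 / 200) /\
  3 * M (inord 2) (inord 1) - 2 * M (inord 2) (inord 2) != 0].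

Lemma open_branch_mx : open branch_mx.
Proof.
pose f (M : 'M[R]_3) := 3 * M (inord 2) (inord 1) - 2 * M (inord 2) (inord 2).
have cf : continuous f.
  have cM (k : R) i j : continuous (fun M : 'M[R]_3 => k * M i j).
    move=> M; apply: (continuous_comp _ (@mulrl_continuous _ k _)).
    exact: coord_continuous.
  by move=> M; exact: cvgB (cM 3 _ _ M) (cM 2 _ _ M).
have -> : branch_mx = (\bigcap_(ij in [set: 'I_3 * 'I_3])
    (fun M : 'M[R]_3 => M ij.1 ij.2) @^-1` ball (word_center ij.1 ij.2) (1 / 200))
    `&` f @^-1` (~` [set 0]).
  apply/seteqP; split=> M [Mr Mt]; split.
  - by move=> [i j] _; rewrite /= /ball /= distrC.
  - by apply/eqP.
  - by move=> i j; have := Mr (i, j) I; rewrite /= /ball /= distrC.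
  - by apply/eqP.
apply: openI; last first.
  by apply: open_comp => [M _|]; [exact: cf|apply: closed_openC; exact: closed_eq].
rewrite openE => M Mr.
exists (fun i j => ball (word_center i j : R) (1 / 200)) => [i j|N Nr [i j] _].
  by apply: open_nbhs_nbhs; split; [exact: ball_open|exact: (Mr (i, j))].
exact: Nr.
Qed.

Lemma branch_mx_near M : branch_mx M -> near_center (1 / 200) M.
Proof. by move=> [Mr _] i j; apply: ltW. Qed.

Lemma branch_mx_posdef M : M^T = M -> branch_mx M -> posdef R M.
Proof.
move=> Ms /branch_mx_near Mr; apply: near_center_posdef => // i j.
by apply: le_trans (Mr i j) _; lra.
Qed.

(** The radius 1/200 fits because 3/200 <= (1/100) (5/2). *)
Lemma branch_mx_close M : branch_mx M -> loewner_close (1 / 100) M word_center.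
Proof. by move=> /branch_mx_near; apply: near_center_close; lra. Qed.

Lemma branch_mx_tail (G : posdef R) : branch_mx (\val G) -> tail_coord (\val G) != 0.
Proof.
move=> [_]; apply: contra => /eqP [_ /eqP]; rewrite subr_eq0 => /eqP t.
have /lt0r_neq0 G0 := posdef_diag_gt0 (inord 2) (set_valP G).
apply/eqP; rewrite -[X in 3 * X](divfK G0) t; lra.
Qed.

Lemma dense_branch_mx M : M^T = M -> forall B, nbhs M B -> B `<=` branch_mx ->
  exists2 G : posdef R, B (\val G) & rationally_independent (\val G).
Proof.
move=> Ms B /nbhs_ballP[e /= e0 MB] Bb.
have [N [Ns Ni MN]] := rationally_independent_dense Ms e0.
have BN : B N by apply: MB; split=> // i j; exact: MN.
by exists (SigSub (mem_set (branch_mx_posdef Ns (Bb _ BN)))).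
Qed.

Definition branch_shapes : set (shape_space R) :=
  @gram_class R @` [set G | branch_mx (\val G)].

(** The preimage in [posdef] is a union, over relabellings and positive scalars, of preimages of
    [branch_mx] under continuous maps. *)
Lemma open_branch_shapes : open branch_shapes.
Proof.
pose act (s : 'S_4) (c : R) (M : 'M[R]_3) := c *: ((perm_coord s)^T *m M *m perm_coord s).
suff E : @gram_class R @^-1` branch_shapes = \bigcup_(sc in [set sc : 'S_4 * R | 0 < sc.2])
    (fun G : posdef R => act sc.1 sc.2 (\val G)) @^-1` branch_mx.
  rewrite /open /= /quotient_open /open /= /quotient_open.
  rewrite -[X in open X]/(@gram_class R @^-1` branch_shapes) E.
  apply: bigcup_open => -[s c] _; apply: open_comp open_branch_mx => G _.
  apply: (@continuous_comp _ _ _ set_val (act s c)); first exact: initial_continuous.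
  apply: (continuous_comp (@continuous_mulmx _ _ _ _ _ _ _ _)).
  exact: scaler_continuous.
apply/seteqP; split=> [G [H Hb /esym/gram_classP[s [c c0 HE]]]|G [[s c] /= c0 Gb]].
  by exists (s, c) => //=; rewrite /act -HE.
have Ap : posdef R (act s c (\val G)).
  apply: branch_mx_posdef Gb; have [Gs _] := perm_coord_posdef s (set_valP G).
  by rewrite /act -[in RHS]Gs; apply/matrixP => i j; rewrite !mxE.
exists (SigSub (mem_set Ap)) => //.
by apply/esym/gram_classP; exists s, c.
Qed.

Lemma rationally_independent_tail M : M^T = M -> rationally_independent M ->
  3 * M (inord 2) (inord 1) - 2 * M (inord 2) (inord 2) != 0.
Proof.
(* The trace of M S is 2 (3 M_21 - 2 M_22). *)
move=> Ms Mi; apply/eqP => M0; pose S : 'M[rat]_3 := sym_mx (0, 0, - 4, 0, 0, 3).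
have S0 : S = 0.
  apply: Mi; first by apply/matrixP => i j; rewrite !mxE;
    elim/ord3P: i; elim/ord3P: j; rewrite !inordK.
  have M12 : M (inord 1) (inord 2) = M (inord 2) (inord 1) by rewrite -[in LHS]Ms mxE.
  rewrite /mxtrace sum3 !mxE !sum3 !mxE !inordK//= !(rmorph0, rmorphN, rmorph_nat) M12.
  lra.
by have /matrixP/(_ (inord 2) (inord 2)) := S0; rewrite !mxE !inordK.
Qed.

Lemma branch_shapes_neq0 : branch_shapes !=set0.
Proof.
(* The center itself fails the second condition, as 3 * 12 = 2 * 18, so an independent matrix near
   it is taken. *)
have [//|N [Ns Ni Nr]] := @rationally_independent_dense R _ (1 / 200) word_center_tr.
have Nb : branch_mx N.
  by split; [move=> i j; rewrite distrC|exact: rationally_independent_tail].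
by exists (gram_class (SigSub (mem_set (branch_mx_posdef Ns Nb))));
  exists (SigSub (mem_set (branch_mx_posdef Ns Nb))).
Qed.

End Shapes.

Theorem theorem1p6 (R : realType) :
  exists O : set (shape_space R),
    [/\ O !=set0,
        open O,
        (forall D : labeled_tetrahedron R, O (tetra_shape D) ->
           exists b : nat -> labeled_tetrahedron R,
             [/\ LEB_branch D b,
                 (exists K : set (shape_space R),
                    compact K /\ forall n, K (tetra_shape (b n)))
               & infinite_set (range (fun n => tetra_shape (b n)))])
      & exists O' : set (shape_space R),
          [/\ O' `<=` O,
              O `<=` closure O',
              null (O `\` O')
            & forall D : labeled_tetrahedron R,
                O' (tetra_shape D) -> tie_free D]].
Proof.
exists branch_shapes.
(* Independence is asked of all representatives; being a class invariant, it holds as soon as one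
   has it. *)
pose O' : set (shape_space R) := branch_shapes `&`
  [set X | forall G, gram_class G = X -> rationally_independent (\val G)].
have O'P (G : posdef R) : branch_mx (\val G) -> rationally_independent (\val G) ->
    O' (gram_class G).
  move=> Gb Gi; split=> [|H HG]; first by exists G.
  exact: rationally_independent_class (esym HG) Gi.
split.
- exact: branch_shapes_neq0.
- exact: open_branch_shapes.
- move=> D [G Gb /esym DG]; have Gc := branch_mx_close Gb.
  have [b [bD bG]] := orbit_branch Gc DG.
  exists b; split=> //.
    (* Whole turns preserve the Loewner ball, which lies in the compact set [near_center (1 / 2)];
       the branch therefore stays in the union of its nine images. *)
    pose F r := (fun G => gram_class (orbit_gram G r)) @`
      [set G : posdef R | near_center (1 / 2) (\val G)].
    exists (\big[setU/set0]_(r < 9) F r); split.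
      by apply: bigsetU_compact => r _; exact: compact_orbit_class.
    move=> n; rewrite bG -bigcup_mkord [in X in gram_class X](divn_eq n 9) addnC orbit_gram_class.
    exists (n %% 9)%N; first by rewrite /= ltn_pmod.
    exists (iter_gram G (n %/ 9)%N) => //=; apply: close_near_center.
      exact: (set_valP (iter_gram G _)).1.
    by elim: (n %/ 9)%N => //= q; exact: cycle_gram_close.
  under eq_fun do rewrite bG.
  exact: infinite_orbit_class (branch_mx_tail Gb).
- exists O'; split.
  + by move=> X [].
  (* As [posdef] carries the initial topology, the neighbourhood B contains the classes of all
     positive definite matrices in some open [W]. *)
  + move=> _ [G Gb <-] B /continuous_gram_class [_ [[W oW <-]]] /= WG WB.
    have [H [BH Hb] Hi] := dense_branch_mx (set_valP G).1
      (filterI (open_nbhs_nbhs (conj oW WG)) (open_nbhs_nbhs (conj open_branch_mx Gb)))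
      (@subIsetr _ _ _).
    by exists (gram_class H); split; [exact: O'P|exact: WB].
  + apply: null_of_dependent => G [[H Hb HG] GO'] Gi; apply: GO'; split; first by exists H.
    by move=> K KG; exact: rationally_independent_class (esym KG) Gi.
  + move=> D [_ Di]; apply: rationally_independent_tie_free.
    exact: (Di (gram_of D)).
Qed.
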